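(* Let $n\ge3$, let $(\pi,v)\in\operatorname{Vert}(D_n)$ and let $a,b\in v([n])$. Then $(\pi,v)$ has a rise labelled $(a,b)$ if and only if $\zeta_D(\pi,v)=(\zeta_D(\pi),d_D(\pi,v))$ has a valley labelled $(b,a)$ or $(-a,-b)$. Moreover, $(\pi,v)$ has a rise labelled $(\pm|a|,b)$ if and only if $\zeta_D(\pi,v)$ has a valley labelled $(b,\pm|a|)$.
   Context: $\mathfrak S_n^B$: bijections $w$ of $\{\pm1,\dots,\pm n\}$ with $w(-i)=-w(i)$; $\mathfrak S_n^D$: those with an even number of $i\in[n]$ with $w(i)<0$. Rise $i$: the $i$-th North step is immediately followed by a North step. Valley $(i,j)$: the $i$-th East step is immediately followed by the $j$-th North step; additionally, if a ballot path with $i$ East and $j$ North steps ends with an East step, $(i,j+1)$ is a valley. Signed steps $E^\pm$ count as East steps. Signed lattice paths $\mathcal L^\bullet_{n-1,n}$: words with $n-1$ East and $n$ North steps whose first step, if East, is replaced by $E^+$ or $E^-$; $\epsilon(\pi)=-1$ iff $\pi$ contains $E^-$. $\pi_i$: number of East steps before the $i$-th North step; $\lambda_1=\epsilon(\pi)\pi_1$, $\lambda_i=\pi_i$ ($1<i<n$), $\lambda_n=2\pi_n-\pi_{n-1}$ if $\pi_1+\dots+\pi_{n-2}$ even, $2n-1-2\pi_n+\pi_{n-1}$ if odd. $\nu=(0,1,\dots,n-2,n-1)$ if $n-1\equiv0,3\pmod4$, $\nu=(0,1,\dots,n-2,n)$ if $n-1\equiv1,2\pmod4$. Area vector $\mu=(\lambda_1,\lambda_2-1,\dots,\lambda_{n-1}-(n-2),\lambda_n-(n-1))$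 in the first case and $(-\lambda_1,\lambda_2-1,\dots,\lambda_{n-1}-(n-2),n-\lambda_n)$ in the second. For $a\in\mathbb Z^n$, $j\ge0$: $\overrightarrow{S}^+_j(a)$ reads left to right writing $N$ for entries $j$ and $E$ for $j+1$; $\overleftarrow{S}^+_j$ reads right to left; $\overrightarrow{S}^-_j,\overleftarrow{S}^-_j$ use $N$ for $-j$ and $E$ for $-j-1$. $\zeta_D(\pi)$: from $\overleftarrow{S}^-_{2n-1}(\mu)\overrightarrow{S}^+_{2n-1}(\mu)\cdots\overleftarrow{S}^-_0(\mu)\overrightarrow{S}^+_0(\mu)$ delete the last letter; if the $n$-th North step is immediately followed by an East step, replace that step by $E^+$ if $\#\{r:\mu_r>0\}$ is even and $E^-$ if odd; $\epsilon(\beta)=-1$ iff a path $\beta$ contains $E^-$. $\operatorname{Vert}(D_n)$: pairs $(\pi,v)$, $\pi\in\mathcal L^\bullet_{n-1,n}$, $v\in\mathfrak S_n^B$, with $v(i)<v(i+1)$ for every rise $i$, $|v(1)|<v(2)$ if $\pi$ begins with two North steps, and $\prod_i\operatorname{sgn}v(i)=\epsilon(\pi)(-1)^{\lambda_{n-1}+\lambda_n}$. $d_D(\pi,v)$: for $i=0,1,2,\dots$ write $v(j)$ for rows $j$ with $\mu_j=-i$ in increasing $j$, then $-v(j)$ for rows $j$ with $\mu_j=i+1$ in decreasing $j$; multiply the entry from row $n$ by $(-1)^{1+\mu_{n-1}+\mu_n}$ and the entry from row $1$ by $\epsilon(\pi)(-1)^{1+\nu_{n-1}+\nu_n}$; then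 change the sign of the first entry if $\mu$ has an odd number of positive entries; the result is the window of $d_D(\pi,v)\in\mathfrak S_n^D$. Labels: a rise $i$ of $(\pi,v)$ is labelled $(v(i),v(i+1))$, except that if $\pi$ begins with two North steps, the rise $1$ is labelled by the formal symbol $(\pm|v(1)|,v(2))$. For $(\beta,w)$ with $\beta$ a signed ballot path of length $2n-1$ and $w\in\mathfrak S_n^D$, a valley $(i,j)$ is labelled $(w(n+1-i),w(n+1-j))$ if $j<n$, $(w(n+1-i),\epsilon(\beta)w(1))$ if $j=n$, $(w(n+1-i),-\epsilon(\beta)w(1))$ if $j=n+1$, $(w(n+1-i),w(n-j))$ if $j>n+1$ (with $w(-k)=-w(k)$); except that if $j=n$ and the $n$-th North step of $\beta$ is followed by another North step, the valley is labelled by the formal symbol $(w(n+1-i),\pm|w(1)|)$. A label $(\pm|a|,b)$ resp. $(b,\pm|a|)$ in the claim means one of these formal symbols with $|v(1)|=|a|$, $v(2)=b$ resp. $w(n+1-i)=b$, $|w(1)|=|a|$.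
   Formalization: The valley (i,n) gets the formal label (w(n+1-i), ±|w(1)|) also when β ends with its n-th North step, not only when that step is followed by another North step; otherwise the claim fails for n=3, π=NNEEN, v=(1,2,3). *)

(* Defs.v *)
From HB Require Import structures.
From mathcomp Require Import all_boot all_order all_algebra.

Set Implicit Arguments.
Unset Strict Implicit.
Unset Printing Implicit Defensive.

Import Order.TTheory GRing.Theory Num.Theory.
Local Open Scope ring_scope.

Inductive step : Type := North | East | EastP | EastM.

Definition step_encode (s : step) : bool * bool :=
  match s with
  | North => (false, false) | East => (true, false)
  | EastP => (false, true) | EastM => (true, true)
  end.

Definition step_decode (c : bool * bool) : step :=
  match c with
  | (false, false) => North | (true, false) => East
  | (false, true) => EastP | (true, true) => EastM
  end.

Lemma step_encodeK : cancel step_encode step_decode.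
Proof. by case. Qed.

HB.instance Definition _ := Countable.copy step (can_type step_encodeK).

Definition is_east (s : step) : bool := s != North.

(* Positions in words are 0-based; the numbering of North steps, East steps,  *)
(* rises, valleys and rows is 1-based.  Indices at which a vector or a signed *)
(* permutation is read are integers, so no subtraction there is truncated.    *)

Definition signed_lattice_path (n : nat) (p : seq step) : bool :=
  [&& count is_east p == n.-1, count_mem North p == n, head North p != East
    & all (fun s => (s == North) || (s == East)) (behead p)].

Definition ballot (p : seq step) : bool :=
  all (fun k => (count is_east (take k p) <= count_mem North (take k p))%N)
      (iota 0 (size p).+1).

Definition eps (p : seq step) : int := if EastM \in p then -1 else 1.

Definition rise (p : seq step) (i : nat) : bool :=
  has (fun k => [&& nth East p k == North, nth East p k.+1 == North
                  & count_mem North (take k.+1 p) == i])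
      (iota 0 (size p)).

Definition valley (p : seq step) (i j : nat) : bool :=
  has (fun k => [&& is_east (nth North p k), nth East p k.+1 == North,
                    count is_east (take k.+1 p) == i
                  & count_mem North (take k.+2 p) == j])
      (iota 0 (size p))
  || [&& ballot p, is_east (last North p), count is_east p == i
       & (count_mem North p).+1 == j].

Definition begins_NN (p : seq step) : bool := prefix [:: North; North] p.

Definition east_heights (p : seq step) : seq nat :=
  [seq count is_east (take k p) | k <- iota 0 (size p) & nth East p k == North].

Definition pi_ (p : seq step) (i : nat) : nat := nth 0%N (east_heights p) i.-1.

Definition lambda_ (n : nat) (p : seq step) (i : nat) : int :=
  if i == 1%N then eps p * (pi_ p 1)%:Z
  else if (i < n)%N then (pi_ p i)%:Z
  else if ~~ odd (\sum_(1 <= k < n.-1) pi_ p k) then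
    2 * (pi_ p n)%:Z - (pi_ p n.-1)%:Z
  else 2 * n%:Z - 1 - 2 * (pi_ p n)%:Z + (pi_ p n.-1)%:Z.

Definition nu_case (n : nat) : bool := (n.-1 %% 4 \in [:: 0; 3])%N.

Definition nu_ (n i : nat) : int :=
  if (i < n)%N then i%:Z - 1 else if nu_case n then n%:Z - 1 else n%:Z.

Definition mu_ (n : nat) (p : seq step) (i : nat) : int :=
  if nu_case n then lambda_ n p i - (i%:Z - 1)
  else if i == 1%N then - lambda_ n p 1
  else if (i < n)%N then lambda_ n p i - (i%:Z - 1)
  else n%:Z - lambda_ n p n.

Definition rows (n : nat) : seq nat := iota 1 n.

Definition area_vector (n : nat) (p : seq step) : seq int :=
  [seq mu_ n p i | i <- rows n].

Definition sweep (x y : int) (a : seq int) : seq step :=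
  pmap (fun t => if t == x then Some North
                 else if t == y then Some East else None) a.

Definition sweepLR_plus (j : nat) (a : seq int) := sweep j%:Z (j%:Z + 1) a.
Definition sweepRL_plus (j : nat) (a : seq int) := sweepLR_plus j (rev a).
Definition sweepLR_minus (j : nat) (a : seq int) :=
  sweep (- j%:Z) (- j%:Z - 1) a.
Definition sweepRL_minus (j : nat) (a : seq int) := sweepLR_minus j (rev a).

Definition sign_peak (m : nat) (e : step) (p : seq step) : seq step :=
  mkseq (fun k =>
    if [&& is_east (nth North p k), (0 < k)%N, nth East p k.-1 == North
         & count_mem North (take k p) == m]
    then e else nth North p k) (size p).

Definition num_pos (a : seq int) : nat := count (fun t : int => 0 < t) a.

Definition zeta_word (n : nat) (a : seq int) : seq step :=
  flatten [seq sweepRL_minus j a ++ sweepLR_plus j a | j <- rev (iota 0 n.*2)].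

Definition zeta_path (n : nat) (p : seq step) : seq step :=
  let a := area_vector n p in
  let w := zeta_word n a in
  sign_peak n (if odd (num_pos a) then EastM else EastP) (take (size w).-1 w).

(* The elements of {+-1, ..., +-n}. *)
Definition pm_range (n : nat) (k : int) : bool := (0 < `|k| <= n)%N.

(* Only the values on {+-1, ..., +-n} of such a function matter. *)
Definition signed_perm (n : nat) (w : int -> int) : Prop :=
  [/\ forall i, pm_range n i -> pm_range n (w i),
      forall i j, pm_range n i -> pm_range n j -> w i = w j -> i = j,
      forall k, pm_range n k -> exists2 i, pm_range n i & w i = k
    & forall i, pm_range n i -> w (- i) = - w i].

Definition of_window (s : seq int) (k : int) : int := sgz k * s`_(`|k|%N.-1).

Definition vertD (n : nat) (p : seq step) (v : int -> int) : Prop :=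
  [/\ signed_lattice_path n p,
      signed_perm n v,
      forall i : nat, rise p i -> v i%:Z < v i.+1%:Z,
      begins_NN p -> `|v 1| < v 2
    & \prod_(1 <= i < n.+1) sgz (v i%:Z)
        = eps p * (-1) ^ (lambda_ n p n.-1 + lambda_ n p n)].

Definition row_sign (n : nat) (p : seq step) (j : nat) : int :=
  (if j == n then (-1) ^ (1 + mu_ n p n.-1 + mu_ n p n) else 1)
  * (if j == 1%N then eps p * (-1) ^ (1 + nu_ n n.-1 + nu_ n n) else 1).

(* All area vector entries lie in [-2n+1, 2n], so i < 2n reaches every row. *)
Definition d_word (n : nat) (p : seq step) (v : int -> int) : seq int :=
  flatten [seq
      [seq row_sign n p j * v j%:Z | j <- rows n & mu_ n p j == - i%:Z]
      ++ [seq row_sign n p j * - v j%:Z | j <- rev (rows n)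
                                        & mu_ n p j == i%:Z + 1]
    | i <- iota 0 n.*2].

Definition neg_head (s : seq int) : seq int :=
  if s is x :: s' then - x :: s' else s.

Definition d_perm (n : nat) (p : seq step) (v : int -> int) : int -> int :=
  of_window (if odd (num_pos (area_vector n p)) then neg_head (d_word n p v)
             else d_word n p v).

Definition zetaD (n : nat) (pv : seq step * (int -> int)) :
  seq step * (int -> int) := (zeta_path n pv.1, d_perm n pv.1 pv.2).

(* [PmFst c b] and [PmSnd b c] are the formal symbols (+-c, b) and (b, +-c). *)
Inductive label : Type :=
  | Lab of int & int
  | PmFst of int & int
  | PmSnd of int & int.

Definition rise_label (pv : seq step * (int -> int)) (i : nat) : label :=
  let: (p, v) := pv in
  if (i == 1%N) && begins_NN p then PmFst `|v 1| (v 2)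
  else Lab (v i%:Z) (v i.+1%:Z).

(* A path of length 2n-1 may end with its n-th North step.  This counts as    *)
(* being followed by North: for [zeta_path], the deleted letter is then North. *)
Definition north_followed_by_north (n : nat) (b : seq step) : bool :=
  rise b n || (last East b == North) && (count_mem North b == n).

Definition valley_label (n : nat) (bw : seq step * (int -> int)) (i j : nat) :
  label :=
  let: (b, w) := bw in
  let x := w (n%:Z + 1 - i%:Z) in
  if (j < n)%N then Lab x (w (n%:Z + 1 - j%:Z))
  else if j == n then
    if north_followed_by_north n b then PmSnd x `|w 1| else Lab x (eps b * w 1)
  else if j == n.+1 then Lab x (- eps b * w 1)
  else Lab x (w (n%:Z - j%:Z)).

Definition has_rise_labelled (pv : seq step * (int -> int)) (l : label) : Prop :=
  exists2 i : nat, rise pv.1 i & rise_label pv i = l.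

Definition has_valley_labelled (n : nat) (bw : seq step * (int -> int))
  (l : label) : Prop :=
  exists i j : nat, valley bw.1 i j /\ valley_label n bw i j = l.

(* Main.v *)
(* Every row r with mu_r <> 0 contributes one North and one East letter to the
   sweep word, and a zero row contributes two North letters.  The window of
   d_D lists the rows in the order opposite to the one in which the word meets
   them, so that the label of a valley only depends on the two rows and on the
   two sweeps from which its letters come.  What remains is to decide which
   letters are adjacent.  Since mu drops by at most one from a row to the next,
   an intermediate value argument shows that an East letter followed by a North
   letter in the same sweep comes from consecutive rows forming a rise.  The
   type D conditions |mu_1| <= mu_2 + 1 and mu_n <= 2 - mu_(n-1) make the same
   argument work when the two letters belong to consecutive sweeps: these are
   the rises in rows 1, 2 with mu_1 < 0, and in rows n-1, n with
   mu_n = 2 - mu_(n-1).  The n-th North letter is followed by a North letter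
   exactly when mu_1 = 0, which is where the formal labels come from. *)

Require Import Defs.
From mathcomp Require Import all_boot all_order all_algebra.
From mathcomp Require Import zify.
Import Order.TTheory GRing.Theory Num.Theory.
Local Open Scope ring_scope.
Set Implicit Arguments.
Unset Strict Implicit.
Unset Printing Implicit Defensive.

(** * Splitting a list at a counted or at a unique entry *)

Lemma split_count (T : Type) (a : pred T) k s : (k < count a s)%N ->
  exists s1 x s2, [/\ s = s1 ++ x :: s2, a x & count a s1 = k].
Proof.
elim: s k => // x s IH k /=; case: (boolP (a x)) => hx /=.
  case: k => [|k] hk; first by exists [::], x, s.
  have [|s1 [y [s2 [-> hy hc]]]] := IH k; first lia.
  by exists (x :: s1), y, s2; rewrite /= hx hc.
rewrite add0n => /IH[s1 [y [s2 [-> hy hc]]]].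
by exists (x :: s1), y, s2; rewrite /= (negbTE hx) hc.
Qed.

Lemma uniq_split_eq (T : eqType) (x : T) s1 s2 t1 t2 : uniq (s1 ++ x :: s2) ->
  s1 ++ x :: s2 = t1 ++ x :: t2 -> s1 = t1.
Proof.
move=> hu heq; have hu' := hu; rewrite heq in hu'.
have h u1 u2 : uniq (u1 ++ x :: u2) -> index x (u1 ++ x :: u2) = size u1.
  rewrite cat_uniq /= => /and3P[_ /norP[hx _] _].
  by rewrite index_cat (negbTE hx) /= eqxx addn0.
have hsz : size s1 = size t1 by rewrite -(h _ _ hu) -(h _ _ hu') heq.
by rewrite -(take_size_cat (x :: s2) (erefl (size s1))) heq hsz take_size_cat.
Qed.

(** * Heights of the North steps and rises *)

Fixpoint heights (c : nat) (p : seq step) : seq nat :=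
  if p is s :: p' then
    if s == North then c :: heights c p' else heights c.+1 p'
  else [::].

Lemma iota0S k : iota 0 k.+1 = 0%N :: map S (iota 0 k).
Proof. by rewrite /= -[1%N]addn0 iotaDl. Qed.

Lemma heightsE c p :
  heights c p = [seq (c + count is_east (take k p))%N
                | k <- iota 0 (size p) & nth East p k == North].
Proof.
elim: p c => // s p IH c.
have -> : iota 0 (size (s :: p)) = 0%N :: map S (iota 0 (size p)) by exact: iota0S.
rewrite [filter _ _]/= filter_map.
have h t : [seq (c + count is_east (take k (s :: p)))%N | k <- map S t]
       = [seq (c + is_east s + count is_east (take k p))%N | k <- t].
  by rewrite -map_comp; apply: eq_map => k /=; rewrite addnA.
have h' t : filter (preim S (fun k => nth East (s :: p) k == North)) t
       = filter (fun k => nth East p k == North) t by [].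
rewrite h' /= (fun_if (map _)) [map _ (_ :: _)]/= h -IH addn0 /is_east.
by case: (s =P North) => _ /=; rewrite ?addn0 ?addn1.
Qed.

Lemma east_heightsE p : east_heights p = heights 0 p.
Proof. by rewrite heightsE. Qed.

Lemma rise_cons s p i :
  rise (s :: p) i = (s == North) && (head East p == North) && (i == 1%N)
    || (if s == North then (0 < i)%N && rise p i.-1 else rise p i).
Proof.
rewrite /rise.
have -> : iota 0 (size (s :: p)) = 0%N :: map S (iota 0 (size p)) by exact: iota0S.
rewrite [has _ (_ :: _)]/= has_map; congr (_ || _).
  by rewrite take0 /= nth0 -andbA addn0; case: (s == North); rewrite //= [1%N == i]eq_sym.
case: (s =P North) => [->|/eqP/negbTE hs].
  case: i => [|i] /=.
    by apply/negbTE/hasPn => k _ /=; lia.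
  by apply: eq_has => k /=; rewrite add1n eqSS.
by apply: eq_has => k /=.
Qed.

Lemma heights_bounds c p x : x \in heights c p -> (c <= x <= c + count is_east p)%N.
Proof.
elim: p c => // s p IH c /=; rewrite /is_east; case: eqP => _ /=.
  by rewrite inE => /orP[/eqP->|/IH]; rewrite ?/is_east; lia.
by move/IH; rewrite ?/is_east; lia.
Qed.

Lemma size_heights c p : size (heights c p) = count_mem North p.
Proof. by elim: p c => // s p IH c /=; case: eqP => _ /=; rewrite IH. Qed.

Lemma sorted_heights c p : sorted leq (heights c p).
Proof.
elim: p c => // s p IH c /=; case: eqP => _ //=.
rewrite path_sortedE; last exact: leq_trans.
by rewrite IH andbT; apply/allP => x /heights_bounds /andP[].
Qed.

(** No East step separates two successive North steps exactly when both have the same number of East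
    steps before them. The offset [c] counts East steps already read, as the induction on the path
    requires. *)
Lemma rise_heights c p i :
  rise p i = [&& (0 < i)%N, (i < size (heights c p))%N
    & nth 0%N (heights c p) i.-1 == nth 0%N (heights c p) i].
Proof.
elim: p c i => [|s p IH] c i; first by rewrite /= andbF.
rewrite rise_cons /=; case: eqP => _ /=; last by rewrite (IH c.+1).
case: i => [|[|i]] /=; rewrite ?andbF //.
  rewrite andbT (IH c) ltnn orbF !ltnS.
  case: p {IH} => //= t p; case: eqP => [_|_] /=; first by rewrite eqxx.
  (* An East step comes next, so every later height is at least [c.+1]. *)
  case hp: (heights c.+1 p) => [|x h] //=; symmetry; apply/negbTE.
  by have := @heights_bounds c.+1 p x; rewrite hp inE eqxx => /(_ isT); lia.
by rewrite (IH c).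
Qed.

Lemma begins_NNE p : begins_NN p = rise p 1 && (pi_ p 1 == 0%N).
Proof.
rewrite (rise_heights 0) /begins_NN /pi_ east_heightsE /=.
case: p => //= s p; rewrite eq_sym; case: eqP => _ /=.
  case: p => //= t p; rewrite eq_sym; case: eqP => _ /=; first by rewrite prefix0s.
  case hp: (heights 1 p) => [|x h] //=; symmetry; apply/negbTE.
  by have := @heights_bounds 1 p x; rewrite hp inE eqxx => /(_ isT); lia.
case hp: (heights 1 p) => [|x h] //=; symmetry; apply/negbTE.
by have := @heights_bounds 1 p x; rewrite hp inE eqxx => /(_ isT); lia.
Qed.

(** * Area vector and row signs in terms of the heights *)

Lemma expN1_even (z : int) : (-1 : int) ^ (z + z) = 1.
Proof.
rewrite expN1r -signr_odd (_ : odd _ = false) //; lia.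
Qed.

Lemma expN1_odd (z : int) : (-1 : int) ^ (z + z + 1) = -1.
Proof. by rewrite exprzDr ?unitrN1 // expN1_even. Qed.

Section Path.
Variables (n : nat) (p : seq step).
Hypotheses (hn : (3 <= n)%N) (hp : signed_lattice_path n p).

Lemma pi_le i j : (0 < i <= j)%N -> (j <= n)%N -> (pi_ p i <= pi_ p j)%N.
Proof.
case/and4P: hp => _ /eqP hN _ _ hij hj.
rewrite /pi_ east_heightsE; apply: (sorted_leq_nth leq_trans leqnn 0%N (sorted_heights 0 p));
  rewrite ?inE ?size_heights ?hN; lia.
Qed.

Lemma pi_lt i : (0 < i <= n)%N -> (pi_ p i < n)%N.
Proof.
case/and4P: hp => /eqP hE /eqP hN _ _ hi.
have /(@heights_bounds 0) : pi_ p i \in heights 0 p.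
  by rewrite /pi_ east_heightsE mem_nth // size_heights hN; lia.
by rewrite hE; lia.
Qed.

Lemma rise_pi i : rise p i = (0 < i < n)%N && (pi_ p i == pi_ p i.+1).
Proof.
case/and4P: hp => _ /eqP hN _ _.
by rewrite (rise_heights 0) size_heights hN /pi_ east_heightsE andbA.
Qed.

Local Notation m := (mu_ n p).
Local Notation sg := (row_sign n p).

Lemma row_sign_mid i : (1 < i < n)%N -> sg i = 1.
Proof.
move=> hi; rewrite /row_sign ifF ?ifF ?mulr1 //; lia.
Qed.

Lemma mu_mid i : (1 < i < n)%N -> m i = (pi_ p i)%:Z - (i%:Z - 1).
Proof.
move=> hi; rewrite /mu_ /lambda_; have -> : (i == 1%N) = false by lia.
have -> : (i < n)%N by lia.
by case: nu_case.
Qed.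

(** The exponent 1 + nu_{n-1} + nu_n is 2n - 2 in the first case of nu and 2n - 1 in the second. *)
Lemma row_sign_1 : sg 1 = if nu_case n then eps p else - eps p.
Proof.
rewrite /row_sign ifF; last lia.
rewrite eqxx mul1r /nu_ ltnn (_ : (n.-1 < n)%N); last lia.
case: nu_case.
  rewrite (_ : 1 + _ + _ = (n%:Z - 1) + (n%:Z - 1)) ?expN1_even ?mulr1 //; lia.
rewrite (_ : 1 + _ + _ = (n%:Z - 1) + (n%:Z - 1) + 1) ?expN1_odd ?mulrN1 //; lia.
Qed.

Lemma row_sign_1_cases : sg 1 = 1 \/ sg 1 = -1.
Proof. rewrite row_sign_1 /eps; case: nu_case; case: ifP => _; lia. Qed.

(** [row_sign] and [mu_] change sign together between the two cases of nu, so later arguments about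
    row 1 need not distinguish them. *)
Lemma mu_1 : m 1 = sg 1 * (pi_ p 1)%:Z.
Proof. by rewrite row_sign_1 /mu_ /lambda_ /=; case: nu_case; rewrite ?subrr ?subr0 ?mulNr. Qed.

(** The cases of nu and the parity in lambda_n only interchange t and 1 - t. The exponent in
    [row_sign] is then the even number 2(pi_n - n + 2) or the odd number 2(pi_{n-1} - pi_n + 1) + 1,
    so the sign records which of the two occurs. *)
Lemma mu_n : let t := 2 * (pi_ p n)%:Z - (pi_ p n.-1)%:Z - (n%:Z - 1) in
  m n = t /\ sg n = 1 \/ m n = 1 - t /\ sg n = -1.
Proof.
set t := _ - _ => /=.
have hm : m n = t \/ m n = 1 - t.
  rewrite /mu_ /lambda_ ltnn; have -> : (n == 1%N) = false by lia.
  by case: nu_case; case: ifP => _; rewrite /t; lia.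
have hs : sg n = (-1) ^ (1 + m n.-1 + m n).
  by rewrite /row_sign eqxx (_ : (n == 1%N) = false) ?mulr1 //; lia.
have hm1 : m n.-1 = (pi_ p n.-1)%:Z - (n%:Z - 2) by rewrite mu_mid; lia.
rewrite hs hm1; case: hm => ->; [left | right]; split=> //; rewrite /t.
  rewrite (_ : 1 + _ + _ = ((pi_ p n)%:Z - (n%:Z - 2)) + ((pi_ p n)%:Z - (n%:Z - 2))).
    exact: expN1_even.
  lia.
rewrite (_ : 1 + _ + _ = ((pi_ p n.-1)%:Z - (pi_ p n)%:Z + 1)
   + ((pi_ p n.-1)%:Z - (pi_ p n)%:Z + 1) + 1); first exact: expN1_odd.
lia.
Qed.

Lemma mu_bound i : (0 < i <= n)%N -> - n.*2%:Z + 1 < m i < n.*2%:Z.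
Proof.
move=> hi; have h1 := pi_lt hi.
have [->|h1i] := eqVneq i 1%N.
  have h2 : (pi_ p 1 < n)%N by apply: pi_lt; lia.
  by rewrite mu_1; case: row_sign_1_cases => ->; lia.
have [->|hni] := eqVneq i n; last by rewrite mu_mid; lia.
have h2 : (pi_ p n < n)%N by apply: pi_lt; lia.
have h3 : (pi_ p n.-1 <= pi_ p n)%N by apply: pi_le; lia.
by case: mu_n => -[-> _]; lia.
Qed.

Lemma mu_step1 : - (m 2 + 1) <= m 1 <= m 2 + 1.
Proof.
have h3 : (pi_ p 1 <= pi_ p 2)%N by apply: pi_le; lia.
by rewrite mu_1 mu_mid; [case: row_sign_1_cases => -> |]; lia.
Qed.

Lemma mu_step i : (1 < i)%N -> (i.+1 < n)%N -> m i - 1 <= m i.+1.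
Proof.
move=> hi hi'; have h3 : (pi_ p i <= pi_ p i.+1)%N by apply: pi_le; lia.
by rewrite !mu_mid; lia.
Qed.

(** With t as in [mu_n], pi_{n-1} <= pi_n gives t >= mu_{n-1} - 1, and pi_n < n gives t <= 2 -
    mu_{n-1}. This interval is stable under exchanging t and 1 - t. *)
Lemma mu_stepn : m n.-1 - 1 <= m n <= 2 - m n.-1.
Proof.
have h3 : (pi_ p n.-1 <= pi_ p n)%N by apply: pi_le; lia.
have h2 : (pi_ p n < n)%N by apply: pi_lt; lia.
by rewrite (@mu_mid n.-1); [case: mu_n => -[-> _] |]; lia.
Qed.

Lemma rise_lt i : rise p i -> (0 < i < n)%N.
Proof. by rewrite rise_pi => /andP[]. Qed.

(** A rise is the equality case of pi_i <= pi_{i+1}, so it attains one of the bounds that describe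
    an area vector. The same holds for [rise_mu] and [rise_mun]. *)
Lemma rise_mu1 : rise p 1 = (m 1 == sg 1 * (m 2 + 1)).
Proof.
rewrite rise_pi mu_1 mu_mid; last lia.
by case: row_sign_1_cases => ->; lia.
Qed.

Lemma rise_mu i : (1 < i)%N -> (i.+1 < n)%N -> rise p i = (m i.+1 == m i - 1).
Proof. by move=> hi hi'; rewrite rise_pi !mu_mid; lia. Qed.

Lemma rise_mun : rise p n.-1 =
  ((m n == m n.-1 - 1) && (sg n == 1) || (m n == 2 - m n.-1) && (sg n == -1)).
Proof.
rewrite rise_pi (@mu_mid n.-1); last lia.
rewrite (_ : n.-1.+1 = n); last lia.
by case: mu_n => -[-> ->]; lia.
Qed.

(** The opposite sign would force 2 pi_n = 2n - 1. The same parity argument serves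
    [row_sign_n_up]. *)
Lemma row_sign_n_down : m n = m n.-1 - 1 -> sg n = 1.
Proof. by rewrite (@mu_mid n.-1); [case: mu_n => -[-> ->]|]; lia. Qed.

Lemma row_sign_n_up : m n = 2 - m n.-1 -> sg n = -1.
Proof. by rewrite (@mu_mid n.-1); [case: mu_n => -[-> ->]|]; lia. Qed.

Lemma begins_NN_mu : begins_NN p = (m 1 == 0) && (m 2 == -1).
Proof.
rewrite begins_NNE rise_mu1 mu_1 mu_mid; last lia.
by case: row_sign_1_cases => ->; lia.
Qed.

End Path.

(** * The sweep word as a list of letters that remember level, direction and row *)

Section Events.
Variables (n : nat) (m : nat -> int).

(* (j, b, r) is the letter contributed by row r to the left to right sweep S^+_j
   if b is true, and to the right to left sweep S^-_j if b is false. *)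
Definition event : Type := (nat * bool * nat)%type.

Definition north_ev (e : event) : bool :=
  m e.2 == (if e.1.2 then e.1.1%:Z else - e.1.1%:Z).

Definition east_ev (e : event) : bool :=
  m e.2 == (if e.1.2 then e.1.1%:Z + 1 else - e.1.1%:Z - 1).

Definition reading (b : bool) : seq nat := if b then rows n else rev (rows n).

Definition sweep_events (j : nat) (b : bool) : seq event :=
  [seq e <- [seq (j, b, r) | r <- reading b] | north_ev e || east_ev e].

Definition events (L : nat) : seq event :=
  flatten [seq sweep_events j false ++ sweep_events j true | j <- rev (iota 0 L)].

Definition letter (e : event) : step := if north_ev e then North else East.

Definition valued (b : bool) (x : int) : seq nat := [seq r <- reading b | m r == x].

(** The order in which [d_word] lists the rows, kept apart from the entries. *)
Definition window_rows (L : nat) : seq nat :=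
  flatten [seq valued true (- i%:Z) ++ valued false (i%:Z + 1) | i <- iota 0 L].

Lemma rev_iotaS L : rev (iota 0 L.+1) = L :: rev (iota 0 L).
Proof. by rewrite -[L.+1]addn1 iotaD rev_cat. Qed.

Lemma eventsS L :
  events L.+1 = (sweep_events L false ++ sweep_events L true) ++ events L.
Proof. by rewrite /events rev_iotaS. Qed.

Lemma window_rowsS L :
  window_rows L.+1 = window_rows L ++ valued true (- L%:Z) ++ valued false (L%:Z + 1).
Proof. by rewrite /window_rows -[L.+1]addn1 iotaD map_cat flatten_cat /= cats0. Qed.

Lemma sweep_eventsE j b :
  sweep (if b then j%:Z else - j%:Z) (if b then j%:Z + 1 else - j%:Z - 1)
    [seq m r | r <- reading b] = map letter (sweep_events j b).
Proof.
rewrite /sweep /sweep_events; elim: (reading b) => //= r s IH.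
rewrite /north_ev /east_ev /=.
case: b IH => /= IH; (case: eqP => hx /=; first by rewrite IH /letter /north_ev /= hx eqxx);
  case: eqP => hy /=; by rewrite IH // /letter /north_ev /=; case: eqP.
Qed.

Lemma zeta_word_events : zeta_word n [seq m r | r <- rows n] = map letter (events n.*2).
Proof.
rewrite /zeta_word /events map_flatten -map_comp; congr flatten.
apply: eq_map => j /=; rewrite map_cat -!sweep_eventsE.
by rewrite /sweepRL_minus /sweepLR_minus /sweepLR_plus map_rev.
Qed.

Lemma valued_rev b x : rev (valued b x) = valued (~~ b) x.
Proof. by case: b; rewrite /valued -filter_rev //= revK. Qed.

Lemma sweep_north_rows j b :
  [seq e.2 | e <- sweep_events j b & north_ev e] = valued b (if b then j%:Z else - j%:Z).
Proof.
rewrite /sweep_events -filter_predI filter_map -map_comp /valued /=.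
rewrite map_id_in //; apply: eq_filter => r /=; rewrite /north_ev /=.
by case: eqP.
Qed.

Lemma sweep_east_rows j b :
  [seq e.2 | e <- sweep_events j b & ~~ north_ev e] =
  valued b (if b then j%:Z + 1 else - j%:Z - 1).
Proof.
rewrite /sweep_events -filter_predI filter_map -map_comp /valued /=.
rewrite map_id_in //; apply: eq_filter => r /=; rewrite /north_ev /east_ev /=.
case: eqP => //= ->; symmetry; apply/negbTE; case: b; lia.
Qed.

(** Block i of the window, reversed, consists of the rows of the North letters of S^+_{i+1} followed
    by those of S^-_i. The final block is the second reading of the zero rows, in S^+_0. *)
Lemma north_rows L :
  [seq e.2 | e <- events L.+1 & north_ev e] =
  valued false (- L%:Z) ++ rev (window_rows L) ++ valued true 0.
Proof.
elim: L => [|L IH].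
  by rewrite eventsS cats0 filter_cat map_cat !sweep_north_rows.
rewrite eventsS !filter_cat !map_cat !sweep_north_rows IH window_rowsS !rev_cat.
rewrite !valued_rev -!catA; do 2 congr (_ ++ _); congr valued; lia.
Qed.

(** The East letters follow the same reversed order, but zero rows have none and are appended by
    hand. *)
Lemma east_rows L :
  [seq e.2 | e <- events L & ~~ north_ev e] ++ valued false 0 =
  valued false (- L%:Z) ++ rev (window_rows L).
Proof.
elim: L => [|L IH]; first by rewrite /= cats0.
rewrite eventsS !filter_cat !map_cat !sweep_east_rows window_rowsS !rev_cat -!catA IH.
rewrite !valued_rev; congr (_ ++ _); congr valued; lia.
Qed.

Lemma size_window_rows L :
  size (window_rows L) = count (fun r => - L%:Z < m r <= L%:Z) (rows n).
Proof.
elim: L => [|L IH].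
  rewrite /window_rows /=; symmetry; apply/eqP; rewrite -leqn0 leqNgt -has_count.
  by apply/hasPn => r _ /=; lia.
rewrite window_rowsS !size_cat {}IH -[size (valued false _)]size_rev valued_rev /=.
rewrite /valued !size_filter /=; elim: (rows n) => //= r s IH; lia.
Qed.

(** The strict order in which the sweep word meets its letters. It turns adjacency of two letters
    into the absence of a third one between them ([events_between], [events_adjacent]). *)
Definition before (e f : event) : bool :=
  let: (j, b, r) := e in let: (k, c, s) := f in
  (k < j)%N || (j == k) && (~~ b && c || (b == c) && (if b then r < s else s < r)%N).

Lemma before_trans : transitive before.
Proof. by move=> [[j b] r] [[k c] s] [[l d] t] /=; case: b c d => [] [] []; lia. Qed.

Lemma before_irr : irreflexive before.
Proof. by move=> [[j b] r] /=; case: b; lia. Qed.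

Lemma mem_reading b r : (r \in reading b) = (0 < r <= n)%N.
Proof. by case: b; rewrite ?mem_rev mem_iota; lia. Qed.

Lemma mem_sweep_events j b k c r :
  ((k, c, r) \in sweep_events j b) =
  [&& k == j, c == b, (0 < r <= n)%N & north_ev (k, c, r) || east_ev (k, c, r)].
Proof.
rewrite mem_filter andbC [RHS]andbA [RHS]andbA; congr (_ && _).
apply/mapP/idP => [[x]|/andP[/andP[/eqP-> /eqP->] h]].
  by rewrite mem_reading => h [-> -> ->]; rewrite !eqxx.
by exists r; rewrite ?mem_reading.
Qed.

Lemma mem_events L j b r :
  ((j, b, r) \in events L) =
  [&& (j < L)%N, (0 < r <= n)%N & north_ev (j, b, r) || east_ev (j, b, r)].
Proof.
elim: L => [|L IH]; first by rewrite in_nil.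
rewrite eventsS !mem_cat {}IH !mem_sweep_events [(j < L.+1)%N]leq_eqVlt eqSS ltnS.
move: (0 < r <= n)%N (north_ev (j, b, r) || _) => P Q.
by case: (j == L); case: (j < L)%N; case: b; case: P; case: Q.
Qed.

Lemma sorted_reading (b : bool) : pairwise (if b then ltn else gtn) (reading b).
Proof.
case: b; rewrite /reading /rows.
  by rewrite -(sorted_pairwise ltn_trans) iota_ltn_sorted.
have gtn_trans : transitive gtn by move=> x y z /=; lia.
by rewrite -(sorted_pairwise gtn_trans) rev_sorted iota_ltn_sorted.
Qed.

Lemma pairwise_events L : pairwise before (events L).
Proof.
have hs j b : pairwise before (sweep_events j b).
  apply: pairwise_filter; rewrite pairwise_map.
  by apply: sub_pairwise (sorted_reading b) => r s; case: b => /=; lia.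
elim: L => // L IH; rewrite eventsS !pairwise_cat IH !hs !andbT /=.
apply/andP; split; apply/allrelP => -[[j b] r] [[k c] s].
  rewrite mem_cat !mem_sweep_events mem_events /= => h1 h2.
  by apply/orP; left; lia.
rewrite !mem_sweep_events => /and4P[/eqP-> /eqP-> _ _] /and4P[/eqP-> /eqP-> _ _] /=; lia.
Qed.

Lemma events_uniq L : uniq (events L).
Proof. exact: pairwise_uniq before_irr (pairwise_events L). Qed.

Lemma events_between L A1 e f A2 g :
  events L = A1 ++ e :: f :: A2 -> g \in events L -> ~~ (before e g && before g f).
Proof.
move=> hA; have := pairwise_events L; rewrite hA pairwise_cat => /and3P[hr _ h2].
rewrite mem_cat => /orP[hg|].
  move/allrelP: hr => /(_ g e hg); rewrite inE eqxx => /(_ isT) h.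
  apply/negP => /andP[h' _]; have := before_trans h h'; by rewrite before_irr.
rewrite !inE => /or3P[/eqP->|/eqP->|hg]; rewrite ?before_irr ?andbF //.
move: h2 => /= /and3P[_ /allP/(_ g hg) h _].
apply/negP => /andP[_ h']; have := before_trans h h'; by rewrite before_irr.
Qed.

Lemma events_adjacent L e f : e \in events L -> f \in events L -> before e f ->
  (forall g, g \in events L -> ~~ (before e g && before g f)) ->
  exists A1 A2, events L = A1 ++ e :: f :: A2.
Proof.
move=> he hf hef hbt; have := pairwise_events L.
move: hf hbt; case/splitPr: he => A1 A2.
rewrite mem_cat => hf hbt; rewrite pairwise_cat => /and3P[hr _ h2].
have {}hf : f \in A2.
  case/orP: hf => [hf|].
    move/allrelP: hr => /(_ f e hf); rewrite inE eqxx => /(_ isT) h.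
    by have := before_trans h hef; rewrite before_irr.
  by rewrite inE => /orP[/eqP h|//]; rewrite h before_irr in hef.
move: h2 => /= /andP[h3 h4]; case: A2 hf hbt h3 h4 {hr} => // g A2.
rewrite inE => /orP[/eqP->|hf] hbt /=; first by exists A1, A2.
case/andP => heg _ /andP[/allP/(_ f hf) hgf _].
by have := hbt g; rewrite mem_cat !inE eqxx !orbT heg hgf => /(_ isT).
Qed.

End Events.

(* An area vector drops by at most one from each entry to the next, and it still
   does if its first entry is reflected in 0, or its last entry in 1/2. *)
Definition area_condition (n : nat) (m : nat -> int) : Prop :=
  [/\ (3 <= n)%N,
      forall i, (0 < i <= n)%N -> - n.*2%:Z + 1 < m i < n.*2%:Z,
      - (m 2%N + 1) <= m 1%N <= m 2%N + 1,
      forall i, (1 < i)%N -> (i.+1 < n)%N -> m i - 1 <= m i.+1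
    & m n.-1 - 1 <= m n <= 2 - m n.-1].

(** * Intermediate values and adjacent letters of the sweep word *)

Section Core.
Variables (n : nat) (m : nat -> int).
Hypothesis harea : area_condition n m.

Let hn : (3 <= n)%N. Proof. by case: harea. Qed.
Let hb i : (0 < i <= n)%N -> - n.*2%:Z + 1 < m i < n.*2%:Z.
Proof. by case: harea => _ h _ _ _; apply: h. Qed.
Let h1 : - (m 2%N + 1) <= m 1%N <= m 2%N + 1. Proof. by case: harea. Qed.
Let hmid i : (1 < i)%N -> (i.+1 < n)%N -> m i - 1 <= m i.+1.
Proof. by case: harea => _ _ _ h _; apply: h. Qed.
Let hlast : m n.-1 - 1 <= m n <= 2 - m n.-1. Proof. by case: harea. Qed.

Local Notation A := (events n m n.*2).
Local Notation north := (north_ev m).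
Local Notation east := (east_ev m).

Lemma descent i : (0 < i < n)%N -> m i - 1 <= m i.+1.
Proof.
move=> hi; have [->|hi1] := eqVneq i 1%N; first lia.
have [hin|hin] := eqVneq i.+1 n; last by apply: hmid; lia.
by move: hlast; rewrite -hin /=; lia.
Qed.

(** A discrete intermediate value argument by induction on the distance: if the value at the right
    end lies below [c], then one row earlier it is still at most [c]. *)
Lemma value_between x y c : (0 < x <= y)%N -> (y <= n)%N -> m y <= c <= m x ->
  exists2 k, (x <= k <= y)%N & m k = c.
Proof.
move=> /andP[hx hxy]; rewrite -(subnKC hxy); move: (y - x)%N => d {y hxy}.
elim: d => [|d IH] hy hc; first by move: hc; rewrite addn0 => hc; exists x; lia.
have [h|h] := eqVneq (m (x + d.+1)%N) c; first by exists (x + d.+1)%N; lia.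
have hd : m (x + d)%N - 1 <= m (x + d.+1)%N by rewrite addnS; apply: descent; lia.
by case: IH => [||k hk hk']; [lia|lia|exists k; lia].
Qed.

Definition hits (j : nat) (b : bool) (x : nat) : bool :=
  north (j, b, x) || east (j, b, x).

(** The bounds on the entries make the restriction j < 2n on the level automatic. *)
Lemma in_events j b r : ((j, b, r) \in A) = (0 < r <= n)%N && hits j b r.
Proof.
rewrite mem_events /hits; case: (boolP (_ && (_ || _))) => [/andP[hr h]|]; last by rewrite andbF.
rewrite andbT; have := hb hr; move: h; rewrite /north_ev /east_ev /=.
by case: b => /orP[] /eqP -> ; lia.
Qed.

(** Otherwise the interval allowed for mu_1 would be empty; likewise [value_pred_n] for mu_n. These
    bounds serve when row 1 or row n cannot anchor an intermediate value argument. *)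
Lemma value_m2 : -1 <= m 2%N. Proof. by move: h1; lia. Qed.

Lemma value_pred_n : m n.-1 <= 1. Proof. by move: hlast; lia. Qed.

(** If r > 1, some row before r takes the value -j on the way down to -j - 1. The descent starts in
    row 1, or in row 2 if mu_1 is too low, since then |mu_1| <= mu_2 + 1 makes mu_2 positive. *)
Lemma first_east_minus j r : (0 < r <= n)%N -> east (j, false, r) ->
  (forall x, (0 < x < r)%N -> ~~ hits j false x) -> r = 1%N.
Proof.
rewrite /hits /north_ev /east_ev /= => hr /eqP hmr hno.
have [//|hr1] := eqVneq r 1%N.
have hno1 := hno 1%N; have h2 := value_m2.
have [hc|hc] := leP (- j%:Z) (m 1%N).
  have [|||k hk hk'] := @value_between 1 r (- j%:Z); [lia|lia|lia|].
  have [hkr|hkr] := eqVneq k r; first by move: hk'; rewrite hkr; lia.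
  by have := hno k; rewrite hk'; lia.
have hr2 : r != 2%N by apply/eqP => hr2; move: hmr; rewrite hr2; lia.
have [|||k hk hk'] := @value_between 2%N r (- j%:Z); [lia|lia|lia|].
have [hkr|hkr] := eqVneq k r; first by move: hk'; rewrite hkr; lia.
by have := hno k; rewrite hk'; lia.
Qed.

(** The mirror image: the descent from j + 1 to j ends in row n, or in row n-1 if mu_n is too high,
    since then mu_{n-1} <= 2 - mu_n is at most -j. *)
Lemma last_east_plus j r : (0 < r <= n)%N -> east (j, true, r) ->
  (forall x, (r < x <= n)%N -> ~~ hits j true x) -> r = n.
Proof.
rewrite /hits /north_ev /east_ev /= => hr /eqP hmr hno.
have [//|hrn] := eqVneq r n.
have hnon := hno n; have h2 := value_pred_n.
have [hc|hc] := leP (m n) (j%:Z + 1).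
  have [|||k hk hk'] := @value_between r n (j%:Z); [lia|lia|lia|].
  have [hkr|hkr] := eqVneq k r; first by move: hk'; rewrite hkr; lia.
  by have := hno k; rewrite hk'; lia.
have hrn1 : r != n.-1 by apply/eqP => hr2; move: hmr; rewrite hr2; lia.
have [|||k hk hk'] := @value_between r n.-1 (j%:Z); [lia|lia|lia|].
have [hkr|hkr] := eqVneq k r; first by move: hk'; rewrite hkr; lia.
by have := hno k; rewrite hk'; lia.
Qed.

(** Here mu_2 >= j, and a larger value has to come down to mu_{n-1} <= 1. So the letter after an
    East letter that ends S^-_j lies in S^+_j, with no sweep skipped; [minus_nonempty] does the same
    after S^+_{j+1}. *)
Lemma plus_nonempty j : east (j, false, 1%N) -> exists2 x, (0 < x <= n)%N & hits j true x.
Proof.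
rewrite /hits /north_ev /east_ev /= => /eqP hm1; have h2 := value_pred_n.
have [hc|hc] := leP (m 2%N) (j%:Z + 1); first by exists 2%N; lia.
have [|||k hk hk'] := @value_between 2%N n.-1 (j%:Z + 1); [lia|lia|lia|].
by exists k; [lia|rewrite hk' eqxx orbT].
Qed.

Lemma minus_nonempty j : east (j.+1, true, n) -> exists2 x, (0 < x <= n)%N & hits j false x.
Proof.
rewrite /hits /north_ev /east_ev /= => /eqP hm1; have h2 := value_m2.
have [hc|hc] := leP (- j%:Z - 1) (m n.-1); first by exists n.-1; lia.
have [|||k hk hk'] := @value_between 2%N n.-1 (- j%:Z - 1); [lia|lia|lia|].
by exists k; [lia|rewrite hk' eqxx orbT].
Qed.

(** This places the last letter of the sweep word, the one that gets deleted, in S^+_0. *)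
Lemma central_nonempty : exists2 x, (0 < x <= n)%N & hits 0 true x.
Proof.
rewrite /hits /north_ev /east_ev /=; have h2 := value_m2; have h3 := value_pred_n.
have [hc|hc] := eqVneq (m 2%N) (-1); first by exists 1%N; lia.
have [hc'|hc'] := leP 0 (m n.-1); first by exists n.-1; lia.
have [|||k hk hk'] := @value_between 2%N n.-1 0; [lia|lia|lia|].
by exists k; [lia|rewrite hk'].
Qed.

Lemma adjacent_before A1 e f A2 : A = A1 ++ e :: f :: A2 -> before e f.
Proof.
move=> hA; have := pairwise_events n m n.*2; rewrite hA pairwise_cat.
by case/and3P => _ _ /= /and3P[/andP[]].
Qed.

Lemma adjacent_hits A1 j b r k c s A2 : A = A1 ++ (j, b, r) :: (k, c, s) :: A2 ->
  [/\ (0 < r <= n)%N, (0 < s <= n)%N & forall i d x, (0 < x <= n)%N -> hits i d x ->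
    ~~ (before (j, b, r) (i, d, x) && before (i, d, x) (k, c, s))].
Proof.
move=> hA.
have : (j, b, r) \in A by rewrite hA mem_cat inE eqxx orbT.
rewrite in_events => /andP[hr _].
have : (k, c, s) \in A by rewrite hA mem_cat !inE eqxx !orbT.
rewrite in_events => /andP[hs _]; split=> // i d x hx hh.
by apply: events_between hA _; rewrite in_events hx.
Qed.

Lemma last_event e A1 : A = rcons A1 e -> e.1 = (0%N, true).
Proof.
case: e => -[j b] r hA; have [x hx hh] := central_nonempty.
have : (0%N, true, x) \in A by rewrite in_events hx.
rewrite hA mem_rcons inE => /orP[/eqP[-> ->] //|hin].
have := pairwise_events n m n.*2; rewrite hA -cats1 pairwise_cat allrel1r.
by case/and3P => /allP/(_ _ hin) /=; case: b {hA} => //=; case: j.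
Qed.

(** The ways in which an East letter can be followed by a North letter. In [PeakMinus], row 1 forces
    level 0 because mu_2 >= -1; this is the case of two initial North steps. [PeakFirst] and
    [PeakLast] straddle two consecutive sweeps. *)
Variant peak : event -> event -> Prop :=
| PeakMinus j s : m s = - j%:Z -> m s.+1 = - j%:Z - 1 -> (0 < s < n)%N ->
    (s = 1%N -> j = 0%N) -> peak (j, false, s.+1) (j, false, s)
| PeakPlus j r : m r = j%:Z + 1 -> m r.+1 = j%:Z -> (0 < r < n)%N ->
    peak (j, true, r) (j, true, r.+1)
| PeakFirst j : m 1%N = - j%:Z - 1 -> m 2%N = j%:Z ->
    peak (j, false, 1%N) (j, true, 2%N)
| PeakLast j : m n = j%:Z + 2 -> m n.-1 = - j%:Z ->
    peak (j.+1, true, n) (j, false, n.-1).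

Lemma adjacent_peak A1 e f A2 : A = A1 ++ e :: f :: A2 -> east e -> north f -> peak e f.
Proof.
case: e f => [[j b] r] [[k c] s] hA.
have [hr hs hno] := adjacent_hits hA; have := adjacent_before hA.
case: b hA hno => hA hno he hef hf.
(* Here [e] lies in S^+_j; first suppose that [f] has the same level. *)
- have [hjk|hjk] := eqVneq j k.
    have ? : c = true by move: he; rewrite /= hjk; case: (c); lia. 
    subst k c.
    have hrs : (r < s)%N by move: he => /=; lia.
    (* Otherwise the entry of row r+1 is at least j + 2, and the value j + 1 recurs before row [s],
       giving a letter between [e] and [f]. *)
    have hsr : s = r.+1.
      have [//|hsr] := eqVneq s r.+1.
      have hno' x : (r < x < s)%N -> ~~ hits j true x.
        move=> hx; apply/negP => /(hno _ _ x) /=; lia.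
      have := hno' r.+1; have hd := @descent r.
      move: hef hf; rewrite /hits /east_ev /north_ev /= => /eqP hef /eqP hf hno1.
      have [|||x hx hx'] := @value_between r.+1 s (j%:Z + 1); [lia|lia|lia|].
      have [hxs|hxs] := eqVneq x s; first by move: hx'; rewrite hxs; lia.
      have := hno' x; rewrite /hits /north_ev /east_ev /= hx' eqxx orbT; lia.
    subst s; move/eqP: hef => /= hef; move/eqP: hf => /= hf; apply: PeakPlus => //; lia.
  have hkj : (k < j)%N by move: he => /=; lia.
  (* Now [e] ends its sweep, so it comes from row n. The next sweep, one level lower, is not empty
     and therefore contains [f]. *)
  have hrn : r = n.
    apply: last_east_plus hef _ => // x hx; apply/negP => /(hno _ _ x) /=; lia.
  subst r; case: j hA hno he hef hjk hkj => // j hA hno he hef hjk hkj.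
  have [x hx hh] := minus_nonempty hef.
  have := hno _ _ _ hx hh; rewrite /= ltnSn /= => hno1.
  have [hc ?] : c = false /\ k = j.
    by move: hno1; case: (c); [|case: (eqVneq k j)]; split=> //; lia.
  (* S^-_j is read from the right. If [s] were not n-1, then mu_{n-1} < -j - 1, and the descent from
     row [s] would give an East letter read before [f]. *)
  subst k c; have hsn : s = n.-1.
    have [//|hsn] := eqVneq s n.-1.
    have hno' y : (s < y <= n)%N -> ~~ hits j false y.
      by move=> hy; apply/negP => /(hno _ _ y) /=; lia.
    have hno2 := hno' n.-1.
    move: hef hf hno2; rewrite /hits /east_ev /north_ev /= => /eqP hef /eqP hf hno2.
    have hsn' : s <> n by move=> hsn'; move: hf; rewrite hsn'; lia.
    have [|||y hy hy'] := @value_between s n.-1 (- j%:Z - 1); [lia|lia|lia|].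
    have [hys|hys] := eqVneq y s; first by move: hy'; rewrite hys; lia.
    have := hno' y; rewrite /hits /north_ev /east_ev /= hy' eqxx orbT; lia.
  subst s; move/eqP: hef => /= hef; move/eqP: hf => /= hf; apply: PeakLast => //; lia.
(* Now [e] lies in S^-_j. The argument is mirrored: rows 1 and 2 replace rows n and n-1, and the
   next sweep is S^+_j. *)
have [hjk|hjk] := boolP ((j == k) && (c == false)).
  case/andP: hjk => /eqP ? /eqP ?; subst k c.
  have hrs : (s < r)%N by move: he => /=; lia.
  have hsr : r = s.+1.
    have [//|hsr] := eqVneq r s.+1.
    have hno' x : (s < x < r)%N -> ~~ hits j false x.
      move=> hx; apply/negP => /(hno _ _ x) /=; lia.
    have := hno' s.+1; have hd := @descent s.
    move: hef hf; rewrite /hits /east_ev /north_ev /= => /eqP hef /eqP hf hno1.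
    have [|||x hx hx'] := @value_between s.+1 r (- j%:Z); [lia|lia|lia|].
    have [hxs|hxs] := eqVneq x r; first by move: hx'; rewrite hxs; lia.
    have := hno' x; rewrite /hits /north_ev /east_ev /= hx' eqxx; lia.
  subst r; move/eqP: hef => /= hef; move/eqP: hf => /= hf; apply: PeakMinus => //; [lia|].
  by move=> hs1; subst s; lia.
have hr1 : r = 1%N.
  apply: first_east_minus hef _ => // x hx; apply/negP => /(hno _ _ x) /=.
  by move: hjk he => /=; case: (c); lia.
subst r; have [x hx hh] := plus_nonempty hef.
have := hno _ _ _ hx hh; rewrite /= eqxx ltnn /= => hno1.
have [? ?] : c = true /\ k = j.
  by move: hno1 hjk he => /=; case: (c) => /=; split=> //; lia.
subst k c; have hs2 : s = 2%N.
  have [//|hs2] := eqVneq s 2%N.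
  have hno' y : (0 < y < s)%N -> ~~ hits j true y.
    by move=> hy; apply/negP => /(hno _ _ y) /=; lia.
  have hno2 := hno' 2%N.
  move: hef hf hno2; rewrite /hits /east_ev /north_ev /= => /eqP hef /eqP hf hno2.
  have hs1 : s <> 1%N by move=> hs1; move: hf; rewrite hs1; lia.
  have [|||y hy hy'] := @value_between 2%N s (j%:Z + 1); [lia|lia|lia|].
  have [hys|hys] := eqVneq y s; first by move: hy'; rewrite hys; lia.
  have := hno' y; rewrite /hits /north_ev /east_ev /= hy' eqxx orbT; lia.
subst s; move/eqP: hef => /= hef; move/eqP: hf => /= hf; apply: PeakFirst => //; lia.
Qed.

Lemma last_hits A1 j b r s : A = A1 ++ [:: (j, b, r); (0%N, true, s)] ->
  forall x, (s < x <= n)%N -> ~~ hits 0 true x.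
Proof.
move=> hA x hx; apply/negP => hh.
have : (0%N, true, x) \in A by rewrite in_events hh andbT; lia.
have hu := events_uniq n m n.*2; rewrite hA mem_cat !inE.
have hp := pairwise_events n m n.*2; rewrite hA -cat1s catA cats1 -cats1 pairwise_cat in hp.
case/and3P: hp => /allrelP hp _ _.
case/or3P => [hin|/eqP he|/eqP[he]]; last by move: hx; rewrite he; lia.
  by have := hp _ (0%N, true, s) (_ : (0%N, true, x) \in _) (mem_head _ _);
    rewrite mem_cat hin => /(_ isT) /=; lia.
have := hp _ (0%N, true, s) (_ : (0%N, true, x) \in _) (mem_head _ _).
by rewrite mem_cat -he mem_head orbT => /(_ isT) /=; lia.
Qed.

Lemma last_east A1 j b r s : A = A1 ++ [:: (j, b, r); (0%N, true, s)] ->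
  east (0%N, true, s) -> s = n /\ m n = 1.
Proof.
move=> hA hs; have [_ hsn _] := adjacent_hits hA.
have hsn' : s = n by apply: last_east_plus hs _ => // x hx; apply: last_hits hA _ hx.
by move: hs; rewrite hsn' /east_ev => /eqP.
Qed.

(** A final East step of the path is a valley even if the deleted letter was East; this locates that
    case. An East letter ending an earlier sweep is excluded because the sweep after it would supply
    another letter before [f]. *)
Lemma last_two_east A1 e f : A = A1 ++ [:: e; f] -> east e -> east f ->
  [/\ e = (0%N, true, n.-1), f = (0%N, true, n), m n.-1 = 1 & m n = 1].
Proof.
case: e f => [[j b] r] [[k c] s] hA he hf.
have [hk hc] : k = 0%N /\ c = true.
  have := @last_event (k, c, s) (rcons A1 (j, b, r)).
  by rewrite hA -cats1 -cats1 -catA => /(_ erefl) [-> ->].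
subst k c; have [? hmn] := last_east hA hf; subst s.
have [hr _ hno] := adjacent_hits hA; have hbef := adjacent_before hA.
have hmn1 : m n.-1 <= 1 := value_pred_n.
have hrn : (j == 0%N) && b -> (r < n)%N.
  by case/andP => /eqP hj0 hb0; move: hbef; rewrite hj0 hb0 /=; lia.
have hj0 : (j == 0%N) && b.
  apply/negP => /negP hj.
  case: b hA he hno hbef hrn hj => hA he hno hbef hrn hj.
    have ? : r = n.
      apply: last_east_plus he _ => // x hx; apply/negP => /(hno _ _ x) /=; lia.
    subst r; case: j hA he hno hbef hrn hj => // j hA he hno hbef hrn hj.
    have [x hx hh] := minus_nonempty he.
    by have := hno _ _ _ hx hh; rewrite /= ltnSn /=; case: (j).
  have ? : r = 1%N.
    apply: first_east_minus he _ => // x hx; apply/negP => /(hno _ _ x) /=; case: (j); lia.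
  subst r.
  have [x hx hh] := plus_nonempty he.
  have := hno _ _ _ hx hh; rewrite /= eqxx ltnn /=; case: j hA he hno hbef hrn hj {hh} => //=.
  (* At level 0, mu_1 = -1, and only row n could have a letter in S^+_0. Then mu_2 >= 2, and the
     descent to mu_{n-1} <= 1 takes the value 1 before row n. *)
  move=> hA he hno hbef hrn hj _.
  have hno' y : (0 < y < n)%N -> ~~ hits 0 true y.
    by move=> hy; apply/negP => /(hno _ _ y) /=; lia.
  have := hno' n.-1; have := hno' 2%N.
  move: he; rewrite /hits /north_ev /east_ev /= => /eqP hm1 hm2 hmn1'.
  have [|||y hy hy'] := @value_between 2%N n.-1 1; [lia|lia|lia|].
  by have := hno' y; rewrite /hits /north_ev /east_ev /= hy'; lia.
have [? ?] : j = 0%N /\ b = true by case/andP: (hj0) => /eqP.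
subst j b.
have {}hrn := hrn hj0.
have hno' y : (r < y < n)%N -> ~~ hits 0 true y.
  by move=> hy; apply/negP => /(hno _ _ y) /=; lia.
have ? : r = n.-1.
  have [//|hrn1] := eqVneq r n.-1.
  have := hno' n.-1; move: he; rewrite /hits /north_ev /east_ev /= => /eqP hmr hmn1'.
  have [|||y hy hy'] := @value_between r n.-1 0; [lia|lia|lia|].
  have [hyr|hyr] := eqVneq y r; first by move: hy'; rewrite hyr; lia.
  by have := hno' y; rewrite /hits /north_ev /east_ev /= hy'; lia.
by subst r; split=> //; move: he; rewrite /east_ev /= => /eqP.
Qed.

(** Without zero rows mu_2 is positive, so mu_{n-1} < 0 would force a zero on the way down. Hence
    mu_{n-1} = 1, and the letter before the last is the East letter of row n-1. *)
Lemma last_north_east A1 e f : A = A1 ++ [:: e; f] ->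
  (forall x, (0 < x <= n)%N -> m x != 0) -> east f -> east e.
Proof.
case: e f => [[j b] r] [[k c] s] hA h0 hf.
have [hk hc] : k = 0%N /\ c = true.
  have := @last_event (k, c, s) (rcons A1 (j, b, r)).
  by rewrite hA -cats1 -cats1 -catA => /(_ erefl) [-> ->].
subst k c; have [? hmn] := last_east hA hf; subst s.
have [hr _ hno] := adjacent_hits hA; have hbef := adjacent_before hA.
have hmn1 : m n.-1 = 1.
  have := h0 n.-1; have := h0 2%N; have := h0 1%N; have := value_pred_n => h3 h4 h5 h6.
  have [//|hne] := eqVneq (m n.-1) 1.
  have [|||y hy hy'] := @value_between 2%N n.-1 0; [lia|lia|lia|].
  by have := h0 y; rewrite hy'; lia.
have hh : hits 0 true n.-1 by rewrite /hits /north_ev /east_ev /= hmn1.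
have := hno _ _ n.-1 _ hh; move: hbef => /= hbef hno1.
have [? [? ?]] : j = 0%N /\ b = true /\ r = n.-1.
  by move: hno1 hbef; case: b {hno hA} => //=; [case: (j == 0%N) /eqP|]; lia.
by subst j b r; rewrite /east_ev /= hmn1.
Qed.

(** If s > 1, the descent to mu_s = 0 from row 1, or from row 2 if mu_1 is negative, takes the value
    1 earlier, and that row has a letter in S^+_0 between the two. *)
Lemma double_north A1 s A2 : A = A1 ++ (0%N, false, s) :: (0%N, true, s) :: A2 ->
  m s = 0 -> s = 1%N.
Proof.
move=> hA hs; have [hsn _ hno] := adjacent_hits hA.
have [//|hs1] := eqVneq s 1%N.
have hno' y b : (0 < y < s)%N -> ~~ hits 0 b y.
  by move=> hy; apply/negP => /(hno _ _ y) /=; case: b => /=; lia.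
have := hno' 1%N true; have := hno' 1%N false.
have := hno' 2%N true; have := hno' 2%N false.
rewrite /hits /north_ev /east_ev /= => h2 h2' h1' h1''.
have [hc|hc] := leP 1 (m 1%N).
  have [|||y hy hy'] := @value_between 1%N s 1; [lia|lia|lia|].
  have [hys|hys] := eqVneq y s; first by move: hy'; rewrite hys; lia.
  have := hno' y true; rewrite /hits /north_ev /east_ev /= hy'; lia.
have hs2 : s <> 2%N by move=> hs2; move: hs; rewrite hs2; lia.
have [|||y hy hy'] := @value_between 2%N s 1; [lia|lia|lia|].
have [hys|hys] := eqVneq y s; first by move: hy'; rewrite hys; lia.
have := hno' y true; rewrite /hits /north_ev /east_ev /= hy'; lia.
Qed.

Lemma events_adjacent_hits j b r k c s : (0 < r <= n)%N -> (0 < s <= n)%N ->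
  hits j b r -> hits k c s -> before (j, b, r) (k, c, s) ->
  (forall i d x, (0 < x <= n)%N -> hits i d x ->
     ~~ (before (j, b, r) (i, d, x) && before (i, d, x) (k, c, s))) ->
  exists A1 A2, A = A1 ++ (j, b, r) :: (k, c, s) :: A2.
Proof.
move=> hr hs he hf hbef hno; apply: events_adjacent hbef _.
- by rewrite in_events hr.
- by rewrite in_events hs.
by move=> [[i d] x]; rewrite in_events => /andP[hx hh]; apply: hno.
Qed.

Lemma peak_adjacent e f : peak e f -> exists A1 A2, A = A1 ++ e :: f :: A2.
Proof.
case=> [j s hs hs1 hsn _|j r hr hr1 hrn|j hm1 hm2|j hmn hmn1];
  apply: events_adjacent_hits; rewrite /hits /north_ev /east_ev /=; try lia.
- by move=> i [] x hx hh; lia.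
- by move=> i [] x hx hh; lia.
- move=> i [] x hx hh; last lia.
  by have [x1|x1] := eqVneq x 1%N; [rewrite x1 hm1 in hh|]; lia.
move=> i [] x hx hh; first lia.
by have [xn|xn] := eqVneq x n; [rewrite xn hmn in hh|]; lia.
Qed.

Lemma double_north_row1 : m 1%N = 0 ->
  exists A1 A2, A = A1 ++ (0%N, false, 1%N) :: (0%N, true, 1%N) :: A2.
Proof.
move=> hm1; apply: events_adjacent_hits; rewrite /hits /north_ev /east_ev /= ?hm1 //; try lia.
by move=> i [] x hx hh; lia.
Qed.

Lemma last_two_rows : m n.-1 = 1 -> m n = 1 ->
  exists A1, A = A1 ++ [:: (0%N, true, n.-1); (0%N, true, n)].
Proof.
move=> hm1 hmn.
have [A1 [A2 hA]] : exists A1 A2, A = A1 ++ (0%N, true, n.-1) :: (0%N, true, n) :: A2.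
  apply: events_adjacent_hits; rewrite /hits /north_ev /east_ev /= ?hm1 ?hmn //; try lia.
  by move=> i [] x hx hh; lia.
case/lastP: A2 hA => [|A2 [[j b] x] hA]; first by exists A1.
have [hj hb'] : j = 0%N /\ b = true.
  have := @last_event (j, b, x) (A1 ++ [:: (0%N, true, n.-1), (0%N, true, n) & A2]).
  by rewrite hA -!cats1 -!catA => /(_ erefl) [-> ->].
subst j b; have : (0%N, true, x) \in A.
  by rewrite hA mem_cat !inE mem_rcons inE eqxx !orbT.
rewrite in_events => /andP[hx _].
have := pairwise_events n m n.*2; rewrite hA pairwise_cat => /and3P[_ _ /= /and3P[_ h _]].
by move: h; rewrite all_rcons /=; lia.
Qed.

End Core.

(** * Rises, valleys and the ballot condition read off a list with the same pattern of East steps *)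

Lemma nth_map_default (T U : Type) (f : T -> U) x s k : nth (f x) (map f s) k = f (nth x s k).
Proof. by elim: s k => [|y s IH] [|k] /=. Qed.

Section Consecutive.
Variables (T : Type) (a : pred T) (p : seq step) (s : seq T).
Hypothesis hs : map is_east p = map a s.

Lemma count_east_take k : count is_east (take k p) = count a (take k s).
Proof.
transitivity (count id (take k (map is_east p))); first by rewrite -map_take count_map.
by rewrite hs -map_take count_map.
Qed.

Lemma count_north_take k : count_mem North (take k p) = count (predC a) (take k s).
Proof.
transitivity (count negb (take k (map is_east p))).
  by rewrite -map_take count_map; apply: eq_count => x /=; rewrite negbK.
by rewrite hs -map_take count_map.
Qed.

Lemma size_shape : size p = size s.
Proof. by rewrite -(size_map is_east) hs size_map. Qed.

Lemma nth_north k : is_east (nth North p k) = nth false (map a s) k.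
Proof. by rewrite -(nth_map_default is_east) hs. Qed.

Lemma nth_east k : (nth East p k == North) = ~~ nth true (map a s) k.
Proof. by rewrite -hs -[true]/(is_east East) nth_map_default negbK. Qed.

Lemma split_at k : (k.+1 < size s)%N ->
  exists s1 x y s2, s = s1 ++ [:: x, y & s2] /\ size s1 = k.
Proof.
move=> hk; have := cat_take_drop k s; have := size_drop k s.
case: (drop k s) => [|x [|y s2]] /=; try lia.
by move=> _ h; exists (take k s), x, y, s2; rewrite h size_takel //; lia.
Qed.

Lemma take_middle s1 (x y : T) s2 : take (size s1).+1 (s1 ++ [:: x, y & s2]) = rcons s1 x.
Proof. by rewrite -cat_rcons -(size_rcons s1 x) take_size_cat. Qed.

Lemma take_middle2 s1 (x y : T) s2 :
  take (size s1).+2 (s1 ++ [:: x, y & s2]) = rcons (rcons s1 x) y.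
Proof. by rewrite -!cat_rcons -(size_rcons s1 x) -(size_rcons _ y) take_size_cat. Qed.

Lemma nth_middle (d : bool) s1 (x y : T) s2 :
  nth d (map a (s1 ++ [:: x, y & s2])) (size s1) = a x.
Proof. by rewrite map_cat nth_cat size_map ltnn subnn. Qed.

Lemma nth_middle2 (d : bool) s1 (x y : T) s2 :
  nth d (map a (s1 ++ [:: x, y & s2])) (size s1).+1 = a y.
Proof. by rewrite map_cat nth_cat size_map ltnNge leqnSn subSnn. Qed.

Lemma riseP i : reflect
  (exists s1 x y s2, [/\ s = s1 ++ [:: x, y & s2], ~~ a x, ~~ a y & i = (count (predC a) s1).+1])
  (rise p i).
Proof.
apply: (iffP hasP) => [[k _ /and3P[]]|[s1 [x [y [s2 [es hx hy ->]]]]]].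
  rewrite !nth_east count_north_take => hx hy /eqP hi.
  (* Past the end the default step is East, so a North step at position k+1 lies inside the word. *)
  have hk : (k.+1 < size s)%N.
    by rewrite ltnNge; apply: contra hy => h; rewrite nth_default ?size_map.
  have [s1 [x [y [s2 [es hs1]]]]] := split_at hk.
  exists s1, x, y, s2; move: hx hy hi; rewrite -hs1 es nth_middle nth_middle2 take_middle.
  by move=> hx hy <-; split=> //; rewrite -cats1 count_cat /= hx addn0 addn1.
exists (size s1); first by rewrite mem_iota size_shape es size_cat /=; lia.
rewrite !nth_east count_north_take es nth_middle nth_middle2 take_middle hx hy.
by rewrite -cats1 count_cat /= hx addn0 addn1 eqxx.
Qed.

Lemma valleyP i j : reflect
  ((exists s1 x y s2, [/\ s = s1 ++ [:: x, y & s2], a x, ~~ a y,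
      i = (count a s1).+1 & j = (count (predC a) s1).+1]) \/
   (ballot p /\ exists s1 x, [/\ s = rcons s1 x, a x,
      i = (count a s1).+1 & j = (count (predC a) s1).+1]))
  (valley p i j).
Proof.
apply: (iffP orP) => -[].
- case/hasP => k _ /and4P[]; rewrite nth_north nth_east count_north_take count_east_take.
  move=> hx hy /eqP hi /eqP hj; left.
  have hk : (k.+1 < size s)%N.
    by rewrite ltnNge; apply: contra hy => h; rewrite nth_default ?size_map.
  have [s1 [x [y [s2 [es hs1]]]]] := split_at hk.
  exists s1, x, y, s2; move: hx hy hi hj.
  rewrite -hs1 es nth_middle nth_middle2 take_middle take_middle2.
  move=> hx hy <- <-; split=> //; rewrite -!cats1 ?count_cat /= ?count_cat /= hx ?hy; lia.
- case/and4P => hb he /eqP hi /eqP hj; right; split=> //.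
  move: hi hj; rewrite -[p]take_size count_east_take count_north_take size_shape take_size.
  have : last false (map a s) by rewrite -hs -[false]/(is_east North) last_map.
  case/lastP: s => // s1 x; rewrite map_rcons last_rcons => hx <- <-.
  by exists s1, x; split=> //; rewrite -cats1 !count_cat /= hx; lia.
- case=> s1 [x [y [s2 [es hx hy -> ->]]]]; left; apply/hasP.
  exists (size s1); first by rewrite mem_iota size_shape es size_cat /=; lia.
  rewrite nth_north nth_east count_north_take count_east_take es.
  rewrite nth_middle nth_middle2 take_middle take_middle2 hx hy.
  rewrite -!cats1 ?count_cat /= hx ?hy; lia.
case=> hb [s1 [x [es hx -> ->]]]; right; rewrite hb.
have -> : is_east (last North p).
  by rewrite -last_map hs es map_rcons last_rcons.
rewrite -[p]take_size count_east_take count_north_take size_shape take_size es.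
by rewrite -cats1 !count_cat /= hx; lia.
Qed.

Lemma ballotP : reflect
  (forall k, (count a (take k s) <= count (predC a) (take k s))%N) (ballot p).
Proof.
apply: (iffP allP) => [h k|h k _]; last by rewrite count_north_take count_east_take.
have [hk|hk] := leqP k (size s).
  have := h k; rewrite count_north_take count_east_take; apply.
  by rewrite mem_iota size_shape; lia.
have := h (size s); rewrite count_north_take count_east_take take_size take_oversize; last lia.
by apply; rewrite mem_iota size_shape; lia.
Qed.

End Consecutive.

(** * Signing the East step after a given North step *)

Lemma shape_sign_peak k e q : is_east e -> map is_east (sign_peak k e q) = map is_east q.
Proof.
move=> he; apply: (@eq_from_nth _ false); first by rewrite !size_map size_iota.
move=> i; rewrite size_map size_mkseq => hi.
rewrite !(nth_map North) ?size_mkseq // nth_mkseq //.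
by case: ifP => // /and4P[-> _ _ _].
Qed.

Lemma sign_peak_notin k e q x : x != e -> x != North -> x \notin q -> x \notin sign_peak k e q.
Proof.
move=> hxe hxN hxq; apply/negP => /mapP[i]; rewrite mem_iota => hi.
case: ifP => _ h; first by rewrite h eqxx in hxe.
by move: hxq; rewrite h mem_nth.
Qed.

Lemma sign_peak_in q1 g h q2 e : g = North -> is_east h ->
  e \in sign_peak (count_mem North q1).+1 e (q1 ++ [:: g, h & q2]).
Proof.
move=> hg hh; apply/mapP; exists (size q1).+1; first by rewrite mem_iota size_cat /=; lia.
rewrite ifT // take_middle !nth_cat ltnn subnn ltnNge leqnSn subSnn /= hh hg /=.
by rewrite -cats1 count_cat /= addn1.
Qed.

(** * The path zeta_D and the window of d_D *)

Section Zeta.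
Variables (n : nat) (p : seq step) (v : int -> int).
Hypotheses (hn : (3 <= n)%N) (hp : signed_lattice_path n p).

Local Notation m := (mu_ n p).
Local Notation A := (events n m n.*2).
Local Notation north := (north_ev m).
Local Notation east := (east_ev m).
Local Notation not_north := (predC (north_ev m)).
Local Notation D := (window_rows n m n.*2).
Local Notation Z := (valued n m true 0).

Lemma mu_area : area_condition n m.
Proof.
split=> //; [exact: mu_bound|exact: mu_step1|exact: mu_step|exact: mu_stepn].
Qed.

Let hb i (hi : (0 < i <= n)%N) := mu_bound hn hp hi.

Lemma mem_valued b x r : (r \in valued n m b x) = (0 < r <= n)%N && (m r == x).
Proof. by rewrite mem_filter mem_reading andbC. Qed.

Lemma valued_nil b x : (forall r, (0 < r <= n)%N -> m r != x) -> valued n m b x = [::].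
Proof.
move=> h; apply/eqP; rewrite -size_eq0 -leqn0 leqNgt size_filter -has_count.
by apply/hasPn => r; rewrite mem_reading => /h.
Qed.

Lemma doubleE : n.*2 = n.*2.-1.+1. Proof. lia. Qed.

Lemma north_rowsE : [seq e.2 | e <- A & north e] = rev D ++ Z.
Proof.
rewrite doubleE north_rows window_rowsS !rev_cat !valued_rev.
rewrite [valued _ _ _ (_ + 1)]valued_nil ?catA // => r /hb; lia.
Qed.

Lemma east_rowsE : [seq e.2 | e <- A & ~~ north e] ++ rev Z = rev D.
Proof.
rewrite valued_rev east_rows [valued _ _ _ _]valued_nil // => r /hb; lia.
Qed.

Lemma size_window : size D = n.
Proof.
rewrite size_window_rows -[RHS](size_iota 1) -[RHS]count_predT; apply: eq_in_count => r.
rewrite mem_iota => hr; have hr' : (0 < r <= n)%N by lia.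
by have := hb hr' => /=; lia.
Qed.

Lemma window_head : exists D', D = Z ++ D'.
Proof. by rewrite doubleE /window_rows /= oppr0 -catA; eexists. Qed.

Lemma hits_north_or_east j b r : hits m j b r -> ~~ north (j, b, r) -> east (j, b, r).
Proof. by case/orP => [->|]. Qed.

Lemma not_north_east e : e \in A -> ~~ north e -> east e.
Proof.
by case: e => -[j b] r; rewrite (in_events mu_area) => /andP[_]; apply: hits_north_or_east.
Qed.

(** Each row r has a North letter at level |mu_r|, so the n entries of the window cover all n
    rows. *)
Lemma window_uniq : uniq D.
Proof.
apply: (@leq_size_uniq _ (rows n)); first exact: iota_uniq.
  move=> r; rewrite mem_iota => hr.
  suff : r \in rev D ++ Z.
    by rewrite mem_cat mem_rev => /orP[//|]; have [D' ->] := window_head; rewrite mem_cat => ->.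
  rewrite -north_rowsE; apply/mapP.
  have [hm|hm] := leP (m r) 0.
    exists (`|m r|%N, false, r) => //.
    by rewrite mem_filter (in_events mu_area) /hits /north_ev /=; lia.
  exists (`|m r|%N, true, r) => //.
  by rewrite mem_filter (in_events mu_area) /hits /north_ev /=; lia.
by rewrite size_window size_iota.
Qed.

Lemma size_east : (count not_north A + size Z)%N = n.
Proof.
have := congr1 size east_rowsE; rewrite size_cat !size_rev size_map size_filter size_window.
exact.
Qed.

Lemma size_north : count north A = (n + size Z)%N.
Proof.
have := congr1 size north_rowsE; rewrite size_cat size_rev size_map size_filter size_window.
exact.
Qed.

Lemma nth_north_row A1 f A2 : A = A1 ++ f :: A2 -> north f ->
  nth 0%N (rev D ++ Z) (count north A1) = f.2.
Proof.
move=> hA hf; rewrite -north_rowsE hA filter_cat /= hf map_cat nth_cat.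
by rewrite size_map size_filter ltnn subnn.
Qed.

Lemma nth_east_row A1 e A2 : A = A1 ++ e :: A2 -> ~~ north e ->
  nth 0%N (rev D) (count not_north A1) = e.2.
Proof.
move=> hA hf; rewrite -east_rowsE hA filter_cat /= hf map_cat -catA nth_cat.
by rewrite size_map size_filter ltnn subnn.
Qed.

Lemma events_central_last : exists Y, A = Y ++ sweep_events n m 0 true
  /\ all (fun e => e.1 != (0%N, true)) Y.
Proof.
rewrite doubleE; elim: n.*2.-1 => [|L [Y [hE hY]]].
  rewrite eventsS cats0; exists (sweep_events n m 0 false); split=> //.
  by apply/allP => -[[j b] r]; rewrite mem_sweep_events => /and4P[_ /eqP-> _ _]; rewrite /= xpair_eqE andbF.
rewrite eventsS hE; eexists; split; first by rewrite catA.
rewrite !all_cat hY andbT; apply/andP; split;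
  by apply/allP => -[[j b] r]; rewrite mem_sweep_events => /and4P[/eqP-> _ _ _].
Qed.

(* The North letters in S^+_0 are the second ones of the zero rows. *)
Lemma second_copy A1 f A2 : A = A1 ++ f :: A2 -> north f ->
  (n <= count north A1)%N = (f.1 == (0%N, true)).
Proof.
move=> hA hf; have [Y [hY hall]] := events_central_last.
have hcY : count north Y = n.
  have := size_north; rewrite hY count_cat -[X in (_ + X)%N]size_filter.
  by rewrite -(size_map snd) sweep_north_rows; apply: addIn.
have hnth : nth f (filter north A) (count north A1) = f.
  by rewrite hA filter_cat /= hf nth_cat size_filter ltnn subnn.
move: hnth; rewrite hY filter_cat nth_cat size_filter hcY.
have hc : (count north A1 < count north A)%N by rewrite hA count_cat /= hf; lia.
case: (ltnP (count north A1) n) => hlt hnth.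
  have : f \in filter north Y by rewrite -{1}hnth; apply: mem_nth; rewrite size_filter hcY.
  by rewrite mem_filter => /andP[_ /(allP hall)] /negbTE ->.
have : f \in filter north (sweep_events n m 0 true).
  rewrite -{1}hnth; apply: mem_nth; rewrite size_filter.
  by move: hc; rewrite {1}hY count_cat hcY ltn_subLR.
case: (f) => -[j b] r; rewrite mem_filter mem_sweep_events => /and5P[_ /eqP-> /eqP->] //.
Qed.

Definition entry (r : nat) : int :=
  row_sign n p r * (if 0 < m r then - v r%:Z else v r%:Z).

(** This depends only on the row and the direction of the sweep. It agrees with the window entry of
    the row, except for the North letters of S^+_0, where the sign is opposite. *)
Definition ev_label (e : event) : int :=
  (if e.1.2 then -1 else 1) * (row_sign n p e.2 * v e.2%:Z).

Lemma d_wordE : d_word n p v = map entry D.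
Proof.
rewrite /d_word /window_rows map_flatten -map_comp; congr flatten.
apply: eq_map => i /=; rewrite map_cat; congr (_ ++ _); apply/eq_in_map => r;
  rewrite mem_filter /entry => /andP[/eqP-> _]; first by rewrite ifF //; lia.
by rewrite ifT //; lia.
Qed.

Lemma entry_east e : east e -> entry e.2 = ev_label e.
Proof.
case: e => -[j b] r; rewrite /east_ev /entry /ev_label /= => /eqP ->.
by case: b; [rewrite ifT|rewrite ifF]; rewrite ?mulN1r ?mul1r ?mulrN //; lia.
Qed.

Lemma entry_north f : north f ->
  entry f.2 = if f.1 == (0%N, true) then - ev_label f else ev_label f.
Proof.
case: f => -[j b] r; rewrite /north_ev /entry /ev_label /= => /eqP ->.
rewrite xpair_eqE; case: b => /=; last by rewrite andbF ifF ?mul1r //; lia.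
rewrite andbT mulN1r opprK; case: j => [|j] //=.
by rewrite mulrN.
Qed.

Local Notation flip := (odd (num_pos (area_vector n p))).
Local Notation w := (d_perm n p v).

Lemma d_perm_1 : w 1 = if flip then - entry (nth 0%N D 0) else entry (nth 0%N D 0).
Proof.
rewrite /d_perm /of_window sgz1 mul1r d_wordE /=.
by have := size_window; case: D => [|r s] /=; [lia|case: ifP].
Qed.

Lemma d_perm_gt1 k : (1 < k <= n)%N -> w k%:Z = entry (nth 0%N D k.-1).
Proof.
move=> hk; rewrite /d_perm /of_window d_wordE gtr0_sgz; last lia.
rewrite mul1r absz_nat; have := size_window.
case: k hk => [|[|k]] // hk; case: D => [|r s] /=; first lia.
by case: ifP => _ /= [hs]; rewrite (nth_map 0%N) //; lia.
Qed.

Lemma d_permN k : w (- k) = - w k.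
Proof. by rewrite /d_perm /of_window sgzN abszN mulNr. Qed.

Definition sign_step : step := if flip then EastM else EastP.

Lemma sign_step_east : is_east sign_step.
Proof. by rewrite /sign_step; case: ifP. Qed.

Lemma zeta_pathE A' z : A = rcons A' z ->
  zeta_path n p = sign_peak n sign_step (map (letter m) A').
Proof.
move=> hA; rewrite /zeta_path zeta_word_events hA map_rcons size_rcons /=.
by rewrite -cats1 take_size_cat.
Qed.

Lemma zeta_shape A' z : A = rcons A' z -> map is_east (zeta_path n p) = map not_north A'.
Proof.
move=> /zeta_pathE ->; rewrite shape_sign_peak ?sign_step_east // -map_comp.
by apply: eq_map => e /=; rewrite /letter; case: (north e).
Qed.

(** The East letter of a row at level j is preceded by the North letter of the same row at level j +
    1 in the same direction, and no row has two East letters. *)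
Lemma events_prefix_ballot B C : A = B ++ C -> (count not_north B <= count north B)%N.
Proof.
move=> hA; rewrite -!size_filter -!(size_map snd); apply: uniq_leq_size.
  have := window_uniq; rewrite -rev_uniq -east_rowsE hA filter_cat map_cat -catA cat_uniq.
  by case/andP.
move=> r /mapP[e]; rewrite mem_filter => /andP[he heB] ->.
have heA : e \in A by rewrite hA mem_cat heB.
have hee := not_north_east heA he.
case: e he heB heA hee => -[j b] x /= he heB heA hee.
have hx : (0 < x <= n)%N by move: heA; rewrite (in_events mu_area) => /andP[].
have hg : north (j.+1, b, x).
  by move: hee; rewrite /east_ev /north_ev /=; case: (b); lia.
apply/mapP; exists (j.+1, b, x) => //; rewrite mem_filter hg /=.
have : (j.+1, b, x) \in A by rewrite (in_events mu_area) hx /hits hg.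
rewrite hA mem_cat => /orP[//|hC].
have := pairwise_events n m n.*2; rewrite hA pairwise_cat => /andP[/allrelP h _].
by have := h _ _ heB hC; rewrite /=; case: (b); lia.
Qed.

Lemma count_notnot (s : seq event) : count (predC not_north) s = count north s.
Proof. by apply: eq_count => e /=; rewrite negbK. Qed.

Lemma events_rcons : exists A' z, A = rcons A' z.
Proof.
have := size_north; case/lastP: A => [|A' z] /=; first lia.
by move=> _; exists A', z.
Qed.

Lemma zeta_ballot : ballot (zeta_path n p).
Proof.
have [A' [z hA]] := events_rcons; apply/(ballotP (zeta_shape hA)) => k.
have hA2 : A = take k A' ++ (drop k A' ++ [:: z]) by rewrite catA cat_take_drop cats1.
by rewrite count_notnot; exact: events_prefix_ballot hA2.
Qed.

(* If A2 is empty, then f is the deleted last letter: the path is ballot and ends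
   with an East step, which is a valley whether f is North or East. *)
Lemma zeta_valley i j : valley (zeta_path n p) i j <->
  exists A1 e f A2, [/\ A = A1 ++ [:: e, f & A2], ~~ north e, north f || nilp A2,
    i = (count not_north A1).+1 & j = (count north A1).+1].
Proof.
have [A' [z hA]] := events_rcons; have hs := zeta_shape hA.
split.
  case/(valleyP hs) => [[s1 [x [y [s2 [es hx hy -> ->]]]]]|[_ [s1 [x [es hx -> ->]]]]].
    exists s1, x, y, (rcons s2 z); rewrite count_notnot; split=> //.
      by rewrite hA es -!cats1 -!catA.
    by move: hy => /=; rewrite negbK => ->.
  exists s1, x, z, [::]; rewrite count_notnot orbT; split=> //.
  by rewrite hA es -!cats1 -!catA.
case=> A1 [e [f [A2 [hA2 he hf -> ->]]]]; apply/(valleyP hs).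
case/lastP: A2 hA2 hf => [|A2 z'] hA2 hf.
  right; split; first exact: zeta_ballot.
  exists A1, e; rewrite count_notnot; split=> //.
  have : rcons A' z = rcons (rcons A1 e) f by rewrite -hA hA2 -!cats1 -catA.
  by case/rcons_inj.
left; exists A1, e, f, A2; rewrite count_notnot; split=> //.
  have : rcons A' z = rcons (A1 ++ [:: e, f & A2]) z' by rewrite -hA hA2 -!cats1 -catA.
  by case/rcons_inj.
by move: hf => /=; rewrite negbK; case/orP => //; case: (A2).
Qed.

Lemma last_central A1 e : A = rcons A1 e -> e.1 = (0%N, true).
Proof. move=> h; exact (last_event mu_area h). Qed.

Lemma north_event_zero e : north e -> e.1 = (0%N, true) -> m e.2 = 0.
Proof. by case: e => -[j b] r; rewrite /north_ev /= => /eqP hm [hj hb0]; rewrite hm hj hb0. Qed.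

Lemma north_not_east e : north e -> east e = false.
Proof.
case: e => -[j b] r; rewrite /north_ev /east_ev /= => /eqP ->.
by case: b; lia.
Qed.

(** The East side of a valley label thus never reads the first window entry, whose sign may have
    been changed. Either a further East letter follows, or the last letter is a North letter of a
    zero row, which has no East letter. *)
Lemma east_count_lt A1 e f A2 : A = A1 ++ [:: e, f & A2] -> ~~ north e ->
  ((count not_north A1).+1 < n)%N.
Proof.
move=> hA he; have := size_east; have [B [g hg]] : exists B g, f :: A2 = rcons B g.
  by case/lastP: A2 {hA} => [|B g]; [exists [::], f|exists (f :: B), g].
have hg1 : g.1 = (0%N, true).
  by apply: (@last_central (A1 ++ e :: B)); rewrite hA hg -!cats1 -catA.
rewrite hA hg -cats1 !count_cat /= he count_cat /=.
case: (boolP (north g)) => hgn /=; last lia.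
have : g.2 \in Z.
  have : g \in A by rewrite hA hg mem_cat inE mem_rcons inE eqxx !orbT.
  case: (g) hgn hg1 => -[j b] r hgn hg1; rewrite (in_events mu_area) => /andP[hr _].
  by rewrite mem_valued hr (north_event_zero hgn) ?eqxx.
by case: Z => //= r s _; lia.
Qed.

(** The n-th North letter closes the reversed window and the next one opens the second reading of
    the zero rows. Both belong to the first row of the window, so [double_north] applies. *)
Lemma double_north_middle A1 x y A2 : A = A1 ++ [:: x, y & A2] -> north x -> north y ->
  (count north A1).+1 = n -> m 1%N = 0.
Proof.
move=> hA hx hy hc.
have hA' : A = rcons A1 x ++ y :: A2 by rewrite hA -cats1 -catA.
have hcx : count north (rcons A1 x) = n by rewrite -cats1 count_cat /= hx addn0 addn1.
have hx1 : x.1 != (0%N, true) by rewrite -(second_copy hA hx) -ltnNge; apply: eq_leq.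
have hy1 : y.1 = (0%N, true) by apply/eqP; rewrite -(second_copy hA' hy) hcx.
have hrow : x.2 = y.2.
  rewrite -(nth_north_row hA hx) -(nth_north_row hA' hy) hcx.
  have hcz := size_north.
  have hlt : (count north A1 < n)%N by apply: eq_leq.
  rewrite !nth_cat size_rev size_window ltnn subnn hlt nth_rev size_window // hc subnn.
  have [D' ->] := window_head; rewrite nth_cat ifT //.
  by move: hcz; rewrite hA' count_cat hcx /= hy => /addnI <-.
move: hA hx hy hx1 hy1 hrow {hA'}; case: x {hcx} => -[j b] r.
case: y => -[k c] s /= hA hx hy hx1 [hk hc'] hrow.
subst k c s; have hm : m r = 0 by apply: north_event_zero hy _.
have [hj hbf] : j = 0%N /\ b = false.
  by move: hx hx1; rewrite /north_ev /= hm; case: (b); case: (j).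
subst j b; have := double_north mu_area hA hm.
by move=> <-.
Qed.

Lemma double_north_count A1 A2 : A = A1 ++ [:: (0%N, false, 1%N), (0%N, true, 1%N) & A2] ->
  m 1%N = 0 -> (count north A1).+1 = n.
Proof.
move=> hA hm.
have hA' : A = rcons A1 (0%N, false, 1%N) ++ (0%N, true, 1%N) :: A2 by rewrite hA -cats1 -catA.
have hx : north (0%N, false, 1%N) by rewrite /north_ev /= hm.
have hy : north (0%N, true, 1%N) by rewrite /north_ev /= hm.
have h2 : (n <= count north A1)%N = false by rewrite (second_copy hA hx).
have : (n <= count north (rcons A1 (0%N, false, 1%N)))%N by rewrite (second_copy hA' hy).
by rewrite -cats1 count_cat /= hx; lia.
Qed.

(** Otherwise there would be no zero row, against [last_north_east]. So if the path ends with its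
    n-th North step, the deleted letter is North. *)
Lemma last_two_north_east A1 x z : A = A1 ++ [:: x; z] -> north x -> ~~ north z ->
  (count north A1).+1 <> n.
Proof.
move=> hA hx hz hc; have := size_north; rewrite hA count_cat /= hx (negbTE hz) => hZ.
have hz' : east z by apply: not_north_east => //; rewrite hA mem_cat !inE eqxx !orbT.
suff : east x by rewrite north_not_east.
apply: (last_north_east mu_area hA) => // r hr; apply/negP => hm.
have : r \in Z by rewrite mem_valued hr hm.
by case: Z hZ => //= *; lia.
Qed.

Lemma zeta_north_north : north_followed_by_north n (zeta_path n p) = (m 1%N == 0).
Proof.
have [A' [z hA]] := events_rcons; have hs := zeta_shape hA.
have hlastE : (last East (zeta_path n p) == North) = ~~ last true (map not_north A').
  by rewrite -hs -[true]/(is_east East) last_map negbK.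
have hcount : count_mem North (zeta_path n p) = count north A'.
  by rewrite -[zeta_path n p]take_size (count_north_take hs) (size_shape hs) take_size count_notnot.
rewrite /north_followed_by_north hlastE hcount; apply/idP/eqP => [|hm].
  case/orP => [/(riseP hs)|].
    case=> s1 [x [y [s2 [es hx hy hi]]]]; rewrite count_notnot in hi.
    apply: (@double_north_middle s1 x y (rcons s2 z)); rewrite -?hi //.
    - by rewrite hA es -!cats1 -catA.
    - by move: hx; rewrite /= negbK.
    by move: hy; rewrite /= negbK.
  case/lastP: A' hA {hs hlastE hcount} => [|B x] hA //.
  rewrite map_rcons last_rcons /= negbK -cats1 count_cat /= => /andP[hx]; rewrite hx => /eqP hc.
  have hA2 : A = B ++ [:: x; z] by rewrite hA -!cats1 -catA.
  have hc' : (count north B).+1 = n by rewrite -[RHS]hc addn0 addn1.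
  have [hz|hz] := boolP (north z); first exact: double_north_middle hA2 hx hz hc'.
  by have := last_two_north_east hA2 hx hz hc'.
have [B1 [B2 hB]] := double_north_row1 mu_area hm.
have hc := double_north_count hB hm.
have hx : north (0%N, false, 1%N) by rewrite /north_ev /= hm.
have hy : north (0%N, true, 1%N) by rewrite /north_ev /= hm.
case/lastP: B2 hB => [|B2 z'] hB; apply/orP.
  right; have : rcons A' z = rcons (rcons B1 (0%N, false, 1%N)) (0%N, true, 1%N).
    by rewrite -hA hB -!cats1 -catA.
  case/rcons_inj => -> _; rewrite map_rcons last_rcons /= negbK hx -cats1 count_cat /= hx.
  by apply/eqP; rewrite -[RHS]hc; lia.
left; apply/(riseP hs); exists B1, (0%N, false, 1%N), (0%N, true, 1%N), B2.
rewrite count_notnot hc; split; rewrite /= ?negbK ?hx ?hy //.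
have : rcons A' z = rcons (B1 ++ [:: (0%N, false, 1%N), (0%N, true, 1%N) & B2]) z'.
  by rewrite -hA hB -!cats1 -catA.
by case/rcons_inj.
Qed.

(** For mu_1 nonzero the n-th North step is followed by an East step, which becomes E^- exactly when
    the first window entry changes sign, so the two signs cancel. *)
Lemma eps_d_perm_1 : m 1%N != 0 -> eps (zeta_path n p) * w 1 = entry (nth 0%N D 0).
Proof.
move=> hm; have [A' [z hA]] := events_rcons; rewrite d_perm_1 /eps (zeta_pathE hA) /sign_step.
case hflip: flip; last first.
  rewrite ifF ?mul1r //; apply: negbTE; apply: sign_peak_notin => //.
  by apply/negP => /mapP[e _]; rewrite /letter; case: ifP.
rewrite ifT ?mulrNN ?mul1r //.
(* [g] is the n-th North letter. *)
have [|B [g [C [hB hg hc]]]] := @split_count _ north n.-1 A.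
  by rewrite size_north; lia.
have hcn : (count north B).+1 = n by rewrite hc; lia.
case: C hB => [|h C] hB.
  have hg1 : g.1 = (0%N, true) by apply: (@last_central B); rewrite hB cats1.
  by have := second_copy hB hg; rewrite hg1 eqxx; lia.
have [hh|hh] := boolP (north h).
  by move: hm; rewrite (double_north_middle hB hg hh hcn).
case/lastP: C hB => [|C z'] hB; first by have := last_two_north_east hB hg hh hcn.
have : rcons A' z = rcons (B ++ [:: g, h & C]) z' by rewrite -hA hB -!cats1 -catA.
case/rcons_inj => -> _; rewrite map_cat /=.
have -> : sign_peak n = sign_peak (count_mem North (map (letter m) B)).+1.
  congr sign_peak; rewrite count_map -[LHS]hcn; congr _.+1; apply: eq_count => e /=.
  by rewrite /letter; case: ifP.
by apply: sign_peak_in; rewrite /letter ?hg // (negbTE hh).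
Qed.

Lemma nth_window_1 : m 1%N = 0 -> nth 0%N D 0 = 1%N.
Proof.
move=> hm; have [D' ->] := window_head.
have hr : rows n = 1%N :: iota 2 n.-1 by rewrite /rows; case: (n) hn.
by rewrite /valued /reading hr /= hm eqxx.
Qed.

(** * Labels of the valleys of the image *)

Lemma zeta_valley_east_label A1 e f A2 : A = A1 ++ [:: e, f & A2] -> ~~ north e ->
  w (n%:Z + 1 - (count not_north A1).+1%:Z) = ev_label e.
Proof.
move=> hA he; have hlt := east_count_lt hA he.
rewrite (_ : _ - _ = (n - count not_north A1)%N%:Z); last lia.
rewrite d_perm_gt1; last lia.
rewrite -entry_east; last by apply: not_north_east he; rewrite hA mem_cat inE eqxx orbT.
rewrite -(nth_east_row hA he) nth_rev size_window; last lia.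
by congr (entry (nth _ _ _)); lia.
Qed.

(** If mu_1 = 0, the North letter number n + 1 is the second one of row 1 and directly follows the
    first one, so no East letter precedes it. *)
Lemma no_zero_row_first A1 e f A2 : A = A1 ++ [:: e, f & A2] -> ~~ north e ->
  north f || nilp A2 -> count north A1 = n -> m 1%N != 0.
Proof.
move=> hA he hf hc; apply/eqP => hm.
have [B1 [B2 hB]] := double_north_row1 mu_area hm.
have hcB := double_north_count hB hm.
have hx : north (0%N, false, 1%N) by rewrite /north_ev /= hm.
have hy : north (0%N, true, 1%N) by rewrite /north_ev /= hm.
have hB' : A = rcons B1 (0%N, false, 1%N) ++ (0%N, true, 1%N) :: B2.
  by rewrite hB -cats1 -catA.
have hcB' : count north (rcons B1 (0%N, false, 1%N)) = n.
  by rewrite -cats1 count_cat /= hx addn0 addn1.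
have hA' : A = rcons A1 e ++ f :: A2 by rewrite hA -cats1 -catA.
have hcA' : count north (rcons A1 e) = n by rewrite -cats1 count_cat /= (negbTE he) !addn0.
have [hfn|hfn] := boolP (north f); last first.
  have := size_north; move: hf; rewrite (negbTE hfn) => /nilP hnil.
  rewrite hA' hnil count_cat hcA' /= (negbTE hfn) => /addnI.
  have : 1%N \in Z by rewrite mem_valued hm; lia.
  by case: Z.
have hf1 : f.1 = (0%N, true) by apply/eqP; rewrite -(second_copy hA' hfn) hcA'.
have hf2 : f.2 = 1%N.
  by have := nth_north_row hB' hy; rewrite hcB' -(nth_north_row hA' hfn) hcA'.
have hfe : f = (0%N, true, 1%N) by case: (f) hf1 hf2 => a b /= -> ->.
have := events_uniq n m n.*2; rewrite hA' => hu.
have := uniq_split_eq hu; rewrite -hA' hfe => /(_ _ _ hB') /rcons_inj[_ hee].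
by move: he; rewrite hee hx.
Qed.

(** For j <= n the j-th North letter has its row at place n + 1 - j of the window. For j > n the
    place is j - n, and the minus sign in the label undoes the sign between [entry] and [ev_label],
    or negates the label of a deleted East letter. *)
Lemma zeta_valley_label A1 e f A2 : A = A1 ++ [:: e, f & A2] -> ~~ north e ->
  north f || nilp A2 ->
  valley_label n (zetaD n (p, v)) (count not_north A1).+1 (count north A1).+1 =
  if (m 1%N == 0) && ((count north A1).+1 == n) then PmSnd (ev_label e) `|v 1|
  else Lab (ev_label e) (if north f then ev_label f else - ev_label f).
Proof.
move=> hA he hf; rewrite /valley_label /zetaD /= (zeta_valley_east_label hA he).
have hA' : A = rcons A1 e ++ f :: A2 by rewrite hA -cats1 -catA.
have hcA' : count north (rcons A1 e) = count north A1.
  by rewrite -cats1 count_cat /= (negbTE he) !addn0.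
have hZ : (size Z < n)%N.
  by have := size_east; rewrite hA count_cat /= he; lia.
have [hcn|hcn] := ltnP (count north A1) n.
  have hfn : north f.
    apply/negP => /negP hfn; move: hf; rewrite (negbTE hfn) => /nilP hnil.
    by have := size_north; rewrite hA' hnil count_cat hcA' /= (negbTE hfn); lia.
  have hfe : entry f.2 = ev_label f.
    by rewrite (entry_north hfn) -(second_copy hA' hfn) hcA' leqNgt hcn.
  have hrow : nth 0%N D (n - (count north A1).+1) = f.2.
    rewrite -(nth_north_row hA' hfn) hcA' nth_cat size_rev size_window hcn nth_rev size_window //.
  rewrite hfn; have [hc|hc] := eqVneq (count north A1).+1 n; last first.
    rewrite andbF ifT; last lia.
    rewrite (_ : _ - _ = (n - count north A1)%N%:Z); last lia.
    rewrite d_perm_gt1; last lia.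
    by rewrite -hfe -hrow; congr (Lab _ (entry (nth _ _ _))); lia.
  rewrite ifF ?hc ?ltnn // zeta_north_north andbT.
  have [hm|hm] := eqVneq (m 1%N) 0.
    rewrite d_perm_1 nth_window_1 //; congr PmSnd.
    have -> : `|if flip then - entry 1 else entry 1| = `|entry 1| by case: ifP; rewrite ?normrN.
    rewrite /entry hm ltxx normrM.
    by case: (row_sign_1_cases hn hp) => ->; rewrite ?normrN1 ?normr1 mul1r.
  by rewrite eps_d_perm_1 // -hfe -hrow hc subnn.
have hval : entry f.2 = - (if north f then ev_label f else - ev_label f).
  have [hfn|hfn] := boolP (north f).
    by rewrite (entry_north hfn) -(second_copy hA' hfn) hcA' hcn.
  rewrite opprK entry_east //; apply: not_north_east => //.
  by rewrite hA' mem_cat inE eqxx orbT.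
have hrow : nth 0%N D (count north A1 - n) = f.2 /\ (count north A1 - n < n)%N.
  have [hfn|hfn] := boolP (north f).
    have hlt : (count north A1 - n < size Z)%N.
      have := size_north; rewrite hA' count_cat hcA' /= hfn; lia.
    split; last lia.
    rewrite -(nth_north_row hA' hfn) hcA' nth_cat size_rev size_window ltnNge hcn /=.
    by have [D' ->] := window_head; rewrite nth_cat hlt.
  (* The deleted East letter is the last one, so its row stands in the window directly after the
     zero rows. *)
  move: hf; rewrite (negbTE hfn) => /nilP hnil.
  have hcz : (count north A1 - n = size Z)%N.
    by have := size_north; rewrite hA' hnil count_cat hcA' /= (negbTE hfn) => h; lia.
  rewrite hcz; split=> //; rewrite -(nth_east_row hA' hfn).
  have := size_east; rewrite hA' hnil count_cat /= hfn => hE.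
  by rewrite nth_rev size_window; [congr nth|]; lia.
case: hrow => hrow hlt.
rewrite ifF; last lia.
rewrite ifF; last lia.
have -> : ((count north A1).+1 == n) = false by lia.
rewrite andbF; have [hc|hc] := eqVneq (count north A1).+1 n.+1.
  have hm : m 1%N != 0 by apply: no_zero_row_first hA he hf _; case: hc.
  rewrite mulNr eps_d_perm_1 //; move: hrow; case: hc => ->; rewrite subnn => ->.
  by rewrite hval opprK.
rewrite (_ : _ - _ = - ((count north A1).+1 - n)%N%:Z); last lia.
rewrite d_permN d_perm_gt1; last lia.
rewrite (_ : _.-1 = (count north A1 - n)%N); last lia.
by rewrite hrow hval opprK.
Qed.

End Zeta.

(** * Matching rises with valleys *)

Section Correspondence.
Variables (n : nat) (p : seq step) (v : int -> int).
Hypotheses (hn : (3 <= n)%N) (hp : signed_lattice_path n p).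

Local Notation m := (mu_ n p).
Local Notation A := (events n m n.*2).
Local Notation north := (north_ev m).
Local Notation east := (east_ev m).
Local Notation not_north := (predC (north_ev m)).
Local Notation lab := (ev_label n p v).
Let harea := mu_area hn hp.

Definition corresponds (r : nat) (l : label) : Prop :=
  if (r == 1%N) && begins_NN p then l = PmSnd (v 2) `|v 1|
  else l = Lab (v r.+1%:Z) (v r%:Z) \/ l = Lab (- v r%:Z) (- v r.+1%:Z).

(** If mu_1 = 0, the n-th North letter is the one of row 1 in S^-_0. *)
Lemma special_valley A1 e f A2 : A = A1 ++ [:: e, f & A2] -> ~~ north e ->
  north f || nilp A2 ->
  (m 1%N == 0) && ((count north A1).+1 == n) = (m 1%N == 0) && (f == (0%N, false, 1%N)).
Proof.
move=> hA he hf; apply: andb_id2l => /eqP hm.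
have hA' : A = rcons A1 e ++ f :: A2 by rewrite hA -cats1 -catA.
have hcA' : count north (rcons A1 e) = count north A1.
  by rewrite -cats1 count_cat /= (negbTE he) !addn0.
have [B1 [B2 hB]] := double_north_row1 harea hm.
have hx : north (0%N, false, 1%N) by rewrite /north_ev /= hm.
have hcB := double_north_count hn hp hB hm.
apply/eqP/eqP => [hc|hfe]; last first.
  have := events_uniq n m n.*2; rewrite hA' => hu.
  have := uniq_split_eq hu; rewrite -hA' hfe => /(_ _ _ hB) hB1.
  by rewrite -hcA' hB1.
have hfn : north f.
  apply/negP => /negP hfn; move: hf; rewrite (negbTE hfn) => /nilP hnil.
  by have := size_north hn hp; rewrite hA' hnil count_cat hcA' /= (negbTE hfn); lia.
have hnth g s1 s2 : A = s1 ++ g :: s2 -> north g -> nth f (filter north A) (count north s1) = g.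
  by move=> h hg; rewrite h filter_cat /= hg nth_cat size_filter ltnn subnn.
have hcc : count north B1 = count north (rcons A1 e).
  by rewrite hcA'; apply: eq_add_S; rewrite hc hcB.
by have := hnth _ _ _ hB hx; rewrite hcc (hnth _ _ _ hA' hfn).
Qed.

(** Two letters of S^- give (v(r+1), v(r)) and two of S^+ give (-v(r), -v(r+1)). For [PeakFirst] and
    [PeakLast] the two directions differ, and the row sign -1 of row 1 or row n restores one of
    these forms. *)
Lemma peak_corresponds e f : peak n m e f ->
  let r := minn e.2 f.2 in rise p r /\ corresponds r
    (if (m 1%N == 0) && (f == (0%N, false, 1%N)) then PmSnd (lab e) `|v 1|
     else Lab (lab e) (lab f)).
Proof.
have h2 : row_sign n p 2 = 1 by apply: row_sign_mid.
case=> [j s hs hs1 hsn h1|j r hr hr1 hrn|j hm1 hm2|j hmn hmn1].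
- have [es|es] := eqVneq s 1%N.
    have hj := h1 es; subst s j; rewrite minnE /=; split.
      by rewrite (rise_mu1 hn hp) hs hs1 subrK oppr0 mulr0 eqxx.
    rewrite /corresponds (begins_NN_mu hn hp) hs hs1 /=.
    by rewrite /ev_label /= h2 !mul1r.
  have hs2 : (1 < s)%N by lia.
  have hf : (m 1%N == 0) && ((j, false, s) == (0%N, false, 1%N)) = false.
    by apply/negP => /andP[_ /eqP[_ es']]; rewrite es' eqxx in es.
  have [hsg hr] : row_sign n p s.+1 = 1 /\ rise p s.
    have [hsn'|hsn'] := eqVneq s.+1 n; last first.
      by rewrite (row_sign_mid hn hp) ?(rise_mu hn hp) // ?hs ?hs1 ?eqxx //; lia.
    have es' : s = n.-1 by rewrite -hsn'.
    subst s; rewrite hsn' in hs1 *.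
    have hd : m n = m n.-1 - 1 by rewrite hs1 hs.
    by rewrite (rise_mun hn hp) (row_sign_n_down hn hp hd) hd !eqxx.
  rewrite /= (minn_idPr _) //; split=> //; rewrite /corresponds (negbTE es) /= hf; left.
  by rewrite /ev_label /= hsg (row_sign_mid hn hp) ?mul1r //; lia.
- have hf : (m 1%N == 0) && ((j, true, r.+1) == (0%N, false, 1%N)) = false.
    by apply/negP => /andP[_ /eqP[]].
  have [hsg hrise] : row_sign n p r.+1 = 1 /\ rise p r.
    have [hsn'|hsn'] := eqVneq r.+1 n; last first.
      have [er|er] := eqVneq r 1%N; last first.
        by rewrite (row_sign_mid hn hp) ?(rise_mu hn hp) // ?hr ?hr1 ?addrK ?eqxx //; lia.
      subst r; rewrite h2 (rise_mu1 hn hp) hr1 hr; split=> //.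
      (* A positive mu_1 leaves only the sign 1, as pi_1 >= 0. *)
      by have := mu_1 hn hp; case: (row_sign_1_cases hn hp) => ->; rewrite hr; lia.
    have es' : r = n.-1 by rewrite -hsn'.
    subst r; rewrite hsn' in hr1 *.
    have hd : m n = m n.-1 - 1 by rewrite hr hr1; lia.
    by rewrite (rise_mun hn hp) (row_sign_n_down hn hp hd) hd !eqxx.
  have hsgr : row_sign n p r = 1.
    have [er|er] := eqVneq r 1%N; last by apply: row_sign_mid => //; lia.
    subst r; have := mu_1 hn hp; case: (row_sign_1_cases hn hp) => ->; rewrite hr; lia.
  rewrite /= (minn_idPl _) //; split=> //; rewrite /corresponds (begins_NN_mu hn hp) hf.
  have -> : (r == 1%N) && ((m 1%N == 0) && (m 2%N == -1)) = false.
    by apply/negP => /andP[/eqP er /andP[/eqP hm _]]; move: hr; rewrite er hm; lia.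
  by right; rewrite /ev_label /= hsg hsgr !mul1r !mulN1r.
- have hm10 : (m 1%N == 0) = false by rewrite hm1; lia.
  have hsg1 : row_sign n p 1 = -1.
    by have := mu_1 hn hp; case: (row_sign_1_cases hn hp) => ->; rewrite hm1; lia.
  rewrite minnE /=; split; first by rewrite (rise_mu1 hn hp) hsg1 hm1 hm2; lia.
  rewrite /corresponds (begins_NN_mu hn hp) hm10 /=; right.
  by rewrite /ev_label /= hsg1 h2 !mul1r !mulN1r.
have hup : m n = 2 - m n.-1 by rewrite hmn hmn1; lia.
have hsgn := row_sign_n_up hn hp hup.
rewrite /= (minn_idPr _); last lia.
split; first by rewrite (rise_mun hn hp) hsgn hup !eqxx orbT.
have -> : (m 1%N == 0) && ((j, false, n.-1) == (0%N, false, 1%N)) = false.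
  by apply/negP => /andP[_ /eqP[_]]; lia.
rewrite /corresponds ifF; last lia.
left; rewrite /ev_label /= hsgn (row_sign_mid hn hp); last lia.
by rewrite (_ : n.-1.+1 = n) ?mulN1r ?opprK ?mul1r //; lia.
Qed.

(** The excluded rise is the one whose valley uses the deleted East letter. *)
Lemma rise_peak r : rise p r -> (m n.-1 == 1) && (m n == 1) && (r == n.-1) = false ->
  exists e f, peak n m e f /\ minn e.2 f.2 = r.
Proof.
move=> hr hlast; have hrn := rise_lt hp hr.
have hplus j : m r = j%:Z + 1 -> m r.+1 = j%:Z -> exists e f, peak n m e f /\ minn e.2 f.2 = r.
  by move=> h1 h2; do 2 eexists; split; [exact: PeakPlus h1 h2 hrn|rewrite /= (minn_idPl _)].
have hminus j : m r = - j%:Z -> m r.+1 = - j%:Z - 1 -> (r = 1%N -> j = 0%N) ->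
    exists e f, peak n m e f /\ minn e.2 f.2 = r.
  by move=> h1 h2 h3; do 2 eexists; split; [exact: PeakMinus h1 h2 hrn h3|rewrite /= (minn_idPr _)].
(* A descent by one gives two letters of the same sweep, in S^- if mu_r <= 0 and in S^+
   otherwise. *)
have hdown : m r.+1 = m r - 1 -> (r = 1%N -> 0 <= m 1%N) ->
    exists e f, peak n m e f /\ minn e.2 f.2 = r.
  move=> hd hr1; have [hle|hlt] := leP (m r) 0.
    apply: (hminus `|m r|%N); try lia.
    by move=> hr1'; have := hr1 hr1'; rewrite hr1' in hle *; lia.
  by apply: (hplus `|m r - 1|%N); lia.
have [er|er] := eqVneq r 1%N.
  subst r; move: hr; rewrite (rise_mu1 hn hp) => /eqP hm.
  have h0 : 0 <= m 2%N + 1 by have := mu_step1 hn hp; lia.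
  have hsg := row_sign_1_cases hn hp.
  have [hneg|hpos] := ltP (m 1%N) 0; last first.
    by apply: hdown => //; move: hm; case: hsg => ->; lia.
  have hm' : m 1%N = - (m 2%N + 1) by move: hm; case: hsg => ->; lia.
  do 2 eexists; split; first by apply: (@PeakFirst _ _ `|m 2%N|%N); lia.
  by [].
have [ern|ern] := eqVneq r n.-1; last first.
  apply: hdown => [|h]; last by rewrite h eqxx in er.
  by apply/eqP; rewrite -(rise_mu hn hp) //; lia.
have hn1 : n.-1.+1 = n by lia.
subst r; rewrite hn1 in hdown.
move: hr; rewrite (rise_mun hn hp) => /orP[] /andP[/eqP hmn _]; first by apply: hdown => //; lia.
(* Here mu_{n-1} <= 1, and the value 1 is the excluded case, so -mu_{n-1} is a level. *)
have h1 := mu_stepn hn hp.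
have [h|h] := eqVneq (m n.-1) 1; first by move: hlast; rewrite hmn h !eqxx.
do 2 eexists; split; first by apply: (@PeakLast _ _ `|m n.-1|%N); lia.
by rewrite /= (minn_idPr _) //; lia.
Qed.

Lemma valley_corresponds i j : valley (zeta_path n p) i j ->
  exists2 r, rise p r & corresponds r (valley_label n (zetaD n (p, v)) i j).
Proof.
case/(zeta_valley hn hp) => A1 [e [f [A2 [hA he hf -> ->]]]].
rewrite (zeta_valley_label _ hn hp hA he hf) (special_valley hA he hf).
have hee : east e by apply: not_north_east he => //; rewrite hA mem_cat inE eqxx orbT.
case: (boolP (north f)) hf => [hfn _|hfn /= /nilP hnil].
  have [hr hc] := peak_corresponds (adjacent_peak harea hA hee hfn).
  by exists (minn e.2 f.2).
(* [f] is the deleted letter and is East, which leaves only rows n-1 and n, both of value 1. *)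
have hfe : east f by apply: not_north_east hfn => //; rewrite hA mem_cat !inE eqxx !orbT.
rewrite hnil in hA; have [-> -> hm1 hmn] := last_two_east harea hA hee hfe.
have hup : m n = 2 - m n.-1 by rewrite hmn hm1.
have hsgn := row_sign_n_up hn hp hup.
exists n.-1; first by rewrite (rise_mun hn hp) hsgn hup !eqxx orbT.
rewrite andbF /corresponds ifF; last lia.
right; rewrite /ev_label /= hsgn (row_sign_mid hn hp); last lia.
by rewrite (_ : n.-1.+1 = n) ?mulN1r ?opprK ?mul1r //; lia.
Qed.

Lemma rise_corresponds r : rise p r -> exists i j,
  valley (zeta_path n p) i j /\ corresponds r (valley_label n (zetaD n (p, v)) i j).
Proof.
move=> hr; case: (boolP ((m n.-1 == 1) && (m n == 1) && (r == n.-1))); last first.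
  move/negbTE => /(rise_peak hr) [e [f [hef <-]]].
  have [A1 [A2 hA]] := peak_adjacent harea hef.
  have [he hf] : ~~ north e /\ north f.
    case: hef => [j s hs hs1 _ _|j s hs hs1 _|j hm1 hm2|j hmn hmn1];
    rewrite /north_ev /= ?hs ?hs1 ?hm1 ?hm2 ?hmn ?hmn1; split=> //; lia.
  have hf' : north f || nilp A2 by rewrite hf.
  exists (count not_north A1).+1, (count north A1).+1; split.
    by apply/(zeta_valley hn hp); exists A1, e, f, A2.
  rewrite (zeta_valley_label _ hn hp hA he hf') (special_valley hA he hf') hf.
  by have [] := peak_corresponds hef.
case/andP => /andP[/eqP hm1 /eqP hmn] /eqP ->.
have [A1 hA] := last_two_rows harea hm1 hmn.
have he : ~~ north (0%N, true, n.-1) by rewrite /north_ev /= hm1.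
have hf : north (0%N, true, n) || nilp (@nil event) by rewrite orbT.
have hfn : north (0%N, true, n) = false by rewrite /north_ev /= hmn.
exists (count not_north A1).+1, (count north A1).+1; split.
  by apply/(zeta_valley hn hp); exists A1, (0%N, true, n.-1), (0%N, true, n), [::].
rewrite (zeta_valley_label _ hn hp hA he hf) (special_valley hA he hf) hfn.
have hup : m n = 2 - m n.-1 by rewrite hmn hm1.
have hsgn := row_sign_n_up hn hp hup.
rewrite andbF /corresponds ifF; last lia.
right; rewrite /ev_label /= hsgn (row_sign_mid hn hp); last lia.
by rewrite (_ : n.-1.+1 = n) ?mulN1r ?opprK ?mul1r //; lia.
Qed.

End Correspondence.

(** This keeps the two forms of a valley label apart: (b, a) has entries in v([n]), while (-a, -b)
    has none there. *)
Lemma signed_perm_neq_opp n v i j : signed_perm n v -> (0 < i <= n)%N -> (0 < j <= n)%N ->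
  v i%:Z <> - v j%:Z.
Proof.
case=> _ hinj _ hopp hi hj; rewrite -hopp; last by rewrite /pm_range; lia.
by move/hinj => h; have := h _ _; rewrite /pm_range; lia.
Qed.

Theorem theorem5p26 (n : nat) (hn : (3 <= n)%N)
    (p : seq step) (v : int -> int) (hpv : vertD n p v)
    (a b : int)
    (ha : exists2 i : nat, (1 <= i <= n)%N & v i%:Z = a)
    (hb : exists2 i : nat, (1 <= i <= n)%N & v i%:Z = b) :
  (has_rise_labelled (p, v) (Lab a b) <->
     has_valley_labelled n (zetaD n (p, v)) (Lab b a) \/
     has_valley_labelled n (zetaD n (p, v)) (Lab (- a) (- b))) /\
  (has_rise_labelled (p, v) (PmFst `|a| b) <->
     has_valley_labelled n (zetaD n (p, v)) (PmSnd b `|a|)).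
Proof.
case: hpv => hp hv _ _ _; case: ha => ia hia <-; case: hb => ib hib <-.
have hneq r k : rise p r -> (0 < k <= n)%N -> v k%:Z <> - v r%:Z /\ v k%:Z <> - v r.+1%:Z.
  move=> hr hk; have := rise_lt hp hr.
  by split; apply: (signed_perm_neq_opp hv) => //; lia.
split; split.
- case=> r hr /=; have [i [j [hval hc]]] := rise_corresponds v hn hp hr.
  move: hc; rewrite /corresponds /rise_label; case: ifP => // _ hc [<- <-].
  by case: hc => hc; [left|right]; exists i, j.
- case=> -[i [j [hval hl]]]; have [r hr] := valley_corresponds v hn hp hval;
    rewrite hl /corresponds; case: ifP => // hs.
  + case=> -[hb ha]; last by case: (hneq r ib hr hib).
    by exists r => //=; rewrite hs hb ha.
  + case=> -[ha hb]; first by case: (hneq r ia hr hia) => _; rewrite -ha opprK.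
    by exists r => //=; rewrite hs (oppr_inj ha) (oppr_inj hb).
- case=> r hr hl; have [i [j [hval hc]]] := rise_corresponds v hn hp hr.
  exists i, j; split=> //; move: hl hc; rewrite /corresponds /rise_label.
  by case: ifP => // _ hl ->; move: hl; rewrite -[v 2]/(v 2%N%:Z) => -[/(congr1 Posz) h ->]; congr PmSnd.
case=> i [j [hval hl]]; have [r hr] := valley_corresponds v hn hp hval.
rewrite hl /corresponds; case: ifP => hs; last by case.
case=> -> /(congr1 Posz) h; exists r => //=; rewrite hs; congr PmFst; exact: esym.
Qed.
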